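(* Let $R$ be a regular local ring such that the Grothendieck--Serre conjecture holds for $R$ and $\mathbf{SO}_{2n}$. Assume that $2$ is invertible in $R$. Let $Q=\sum_{i,j}q_{ij}x_ix_j$ and $Q'=\sum_{i,j}q'_{ij}x_ix_j$ be quadratic forms in $n$ variables with coefficients in $R$ such that their discriminants are invertible in $R$. Assume that there is a linear transformation with coefficients in the fraction field of $R$ taking $Q$ to $Q'$. Then there is a linear transformation with coefficients in $R$ taking $Q$ to $Q'$.
   Context: $\mathbf{SO}_{2n}$ denotes the split form of the special orthogonal group scheme over $R$, i.e. the special orthogonal group scheme of the quadratic form $x_1x_{n+1}+\dots+x_nx_{2n}$ in $2n$ variables. The Grothendieck--Serre conjecture holds for $R$ and a reductive $R$-group scheme $\mathbf{G}$ if every principal $\mathbf{G}$-bundle over $\operatorname{Spec}R$ that is trivial over the fraction field of $R$ is trivial. The discriminant of a quadratic form is the determinant of the matrix of its polar bilinear form. Over a ring $A$, a linear transformation with coefficients in $A$ taking one form to another means an element of $GL_n(A)$, i.e. an invertible linear change of variables over $A$, transforming the first form into the second. *)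

(* Defs.v *)
From HB Require Import structures.
From mathcomp Require Import all_boot all_order all_algebra.
From mathcomp Require Import mpoly.

Set Implicit Arguments.
Unset Strict Implicit.
Unset Printing Implicit Defensive.

Import GRing.Theory.
Local Open Scope ring_scope.

(** * Regular local rings

    [idealr_closed] (from [ring_quotient]) forces ideals to be proper; the unit
    ideal is generated by 1, so this does not affect [noetherian]. *)

Definition generated_by (R : comNzRingType) (I : {pred R}) (d : nat)
    (f : 'I_d -> R) : Prop :=
  forall x, x \in I <-> exists c : 'I_d -> R, x = \sum_i c i * f i.

Definition noetherian (R : comNzRingType) : Prop :=
  forall I : {pred R}, idealr_closed I ->
    exists (d : nat) (f : 'I_d -> R), generated_by I f.

Definition maximal_ideal (R : comNzRingType) (m : {pred R}) : Prop :=
  idealr_closed m /\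
  forall J : {pred R}, idealr_closed J -> {subset m <= J} -> J =i m.

Definition local_with (R : comNzRingType) (m : {pred R}) : Prop :=
  maximal_ideal m /\ forall m' : {pred R}, maximal_ideal m' -> m' =i m.

Definition prime_ideal (R : comNzRingType) (P : {pred R}) : Prop :=
  idealr_closed P /\ prime_idealr_closed P.

Definition prime_chain (R : comNzRingType) (d : nat)
    (P : 'I_d.+1 -> {pred R}) : Prop :=
  (forall i, prime_ideal (P i)) /\
  (forall i j : 'I_d.+1, (i < j)%N ->
     {subset P i <= P j} /\ exists x, x \in P j /\ x \notin P i).

Definition krull_dim (R : comNzRingType) (d : nat) : Prop :=
  (exists P : 'I_d.+1 -> {pred R}, prime_chain P) /\
  (forall (e : nat) (P : 'I_e.+1 -> {pred R}), prime_chain P -> (e <= d)%N).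

Definition regular_local (R : comNzRingType) : Prop :=
  noetherian R /\
  exists (m : {pred R}) (d : nat),
    [/\ local_with m, krull_dim R d
      & exists f : 'I_d -> R, generated_by m f].

(** * Faithful flatness *)

Definition bilinear_map (R : comNzRingType) (M N P : lmodType R)
    (b : M -> N -> P) : Prop :=
  (forall y, linear (b^~ y)) /\ (forall x, linear (b x)).

(** By the universal property of the tensor product, the sum of the pure
    tensors [x ⊗ y], for [(x, y)] in [t], vanishes in [M ⊗ N] iff every bilinear
    map sends it to 0. *)
Definition tensor_zero (R : comNzRingType) (M N : lmodType R)
    (t : seq (M * N)) : Prop :=
  forall (P : lmodType R) (b : M -> N -> P), bilinear_map b ->
    \sum_(p <- t) b p.1 p.2 = 0.

Definition flat (R : comNzRingType) (B : lmodType R) : Prop :=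
  forall (M N : lmodType R) (f : {linear M -> N}), injective f ->
  forall t : seq (M * B),
    tensor_zero [seq (f p.1, p.2) | p <- t] -> tensor_zero t.

Definition faithfully_flat (R : comNzRingType) (B : lmodType R) : Prop :=
  flat B /\
  forall M : lmodType R,
    (forall t : seq (M * B), tensor_zero t) -> forall x : M, x = 0.

(** * Principal bundles

    A closed subgroup scheme of [GL_m] over [R] is given by its functor of
    points [G], where [G S g] means that [g] is an [S]-point.  A principal
    bundle under such an affine group scheme is automatically an affine scheme,
    by fpqc descent, so it is represented by a commutative [R]-algebra [E], whose
    [S]-points are the algebra morphisms [E -> S].  By Yoneda's lemma, a right
    action is a natural family of actions on [S]-points, and it makes
    [(x, g) |-> (x, x g)] an isomorphism onto the fibre square exactly when [G S]
    acts simply transitively on the [S]-points for every [S].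

    Morphisms are compared pointwise; naturality along the identity says that
    the action is compatible with this. *)

Definition mxfunctor (R : comNzRingType) (m : nat) : Type :=
  forall S : comAlgType R, 'M[S]_m -> Prop.

Record principal_bundle (R : comNzRingType) (m : nat) (G : mxfunctor R m) :=
  PrincipalBundle {
    total : comAlgType R;
    act : forall S : comAlgType R,
      {lrmorphism total -> S} -> 'M[S]_m -> {lrmorphism total -> S};
    act_natural : forall (S T : comAlgType R) (u : {lrmorphism S -> T})
        (x : {lrmorphism total -> S}) (y : {lrmorphism total -> T})
        (g : 'M[S]_m),
      G S g -> (forall b, y b = u (x b)) ->
      forall b, act y (map_mx u g) b = u (act x g b);
    act_one : forall (S : comAlgType R) (x : {lrmorphism total -> S}),
      act x 1%:M =1 x;
    act_mul : forall (S : comAlgType R) (x : {lrmorphism total -> S})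
        (g h : 'M[S]_m),
      G S g -> G S h -> act x (g *m h) =1 act (act x g) h;
    act_simply_transitive : forall (S : comAlgType R)
        (x y : {lrmorphism total -> S}),
      exists! g : 'M[S]_m, G S g /\ act x g =1 y;
    total_faithfully_flat : faithfully_flat total
  }.

(** The base change of [E] to an [R]-algebra [A] is isomorphic to [G_A] acting on
    itself by right translations.  An [A]-algebra is an [R]-algebra [S] together
    with an algebra morphism [a : A -> S]. *)
Definition trivial_over (R : comNzRingType) (m : nat) (G : mxfunctor R m)
    (E : principal_bundle G) (A : comAlgType R) : Prop :=
  exists phi : forall S : comAlgType R,
      {lrmorphism A -> S} -> 'M[S]_m -> {lrmorphism total E -> S},
  [/\ forall (S T : comAlgType R) (a : {lrmorphism A -> S})
        (a' : {lrmorphism A -> T}) (u : {lrmorphism S -> T}) (g : 'M[S]_m),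
        G S g -> (forall c, a' c = u (a c)) ->
        forall b, phi T a' (map_mx u g) b = u (phi S a g b),
      forall (S : comAlgType R) (a : {lrmorphism A -> S}) (g h : 'M[S]_m),
        G S g -> G S h -> phi S a (g *m h) =1 act (phi S a g) h
    & forall (S : comAlgType R) (a : {lrmorphism A -> S})
        (x : {lrmorphism total E -> S}),
        exists! g : 'M[S]_m, G S g /\ phi S a g =1 x].

(** The fraction field as an [R]-algebra. *)
Definition fracalg (R : idomainType) : Type := {fraction R}.

Section FracAlg.
Variable R : idomainType.

HB.instance Definition _ := GRing.Field.on (fracalg R).

Let scale (a : R) (x : fracalg R) : fracalg R := tofrac a * x.

Let scaleA a b x : scale a (scale b x) = scale (a * b) x.
Proof. by rewrite /scale rmorphM mulrA. Qed.
Let scale1 : left_id 1 scale.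
Proof. by move=> x; rewrite /scale rmorph1 mul1r. Qed.
Let scaleDr : right_distributive scale +%R.
Proof. by move=> a x y; rewrite /scale mulrDr. Qed.
Let scaleDl x : {morph scale^~ x : a b / a + b}.
Proof. by move=> a b; rewrite /scale rmorphD mulrDl. Qed.

HB.instance Definition _ :=
  GRing.Zmodule_isLmodule.Build R (fracalg R) scaleA scale1 scaleDr scaleDl.

Let scaleAl (a : R) (x y : fracalg R) : a *: (x * y) = (a *: x) * y.
Proof. exact: mulrA. Qed.

HB.instance Definition _ :=
  GRing.Lmodule_isLalgebra.Build R (fracalg R) scaleAl.

Let scaleAr (a : R) (x y : fracalg R) : a *: (x * y) = x * (a *: y).
Proof. exact: mulrCA. Qed.

HB.instance Definition _ :=
  GRing.Lalgebra_isAlgebra.Build R (fracalg R) scaleAr.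

End FracAlg.

Definition grothendieck_serre (R : idomainType) (m : nat) (G : mxfunctor R m)
    : Prop :=
  forall E : principal_bundle G,
    trivial_over E (fracalg R : comAlgType R) ->
    trivial_over E (R^o : comAlgType R).

(** * Quadratic forms *)

Definition quadform (R : comNzRingType) (n : nat) (q : 'M[R]_n)
    : {mpoly R[n]} :=
  \sum_i \sum_j q i j *: ('X_i * 'X_j).

(** [Q (g x)] *)
Definition lin_subst (R : comNzRingType) (n : nat) (g : 'M[R]_n)
    (Q : {mpoly R[n]}) : {mpoly R[n]} :=
  comp_mpoly [tuple \sum_j g i j *: 'X_j | i < n] Q.

Definition polar (R : comNzRingType) (n : nat) (Q : {mpoly R[n]})
    (x y : 'I_n -> R) : R :=
  Q.@[fun i => x i + y i] - Q.@[x] - Q.@[y].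

Definition discriminant (R : comNzRingType) (n : nat) (Q : {mpoly R[n]}) : R :=
  \det (\matrix_(i, j) polar Q (fun k => (k == i)%:R) (fun k => (k == j)%:R)).

Definition lin_equivalent (R : comUnitRingType) (n : nat)
    (Q Q' : {mpoly R[n]}) : Prop :=
  exists2 g : 'M[R]_n, g \in unitmx & lin_subst g Q = Q'.

Definition split_form (R : comNzRingType) (n : nat) : {mpoly R[n + n]} :=
  \sum_(i < n) 'X_(lshift n i) * 'X_(rshift n i).

(** [SO_2n] of the split form.  Cutting it out of the orthogonal group by the
    determinant is correct only when 2 is invertible in the base ring (in general
    the Dickson invariant is needed). *)
Definition SO_split (R : comNzRingType) (n : nat) : mxfunctor R (n + n) :=
  fun S g => lin_subst g (split_form S n) = split_form S n /\ \det g = 1.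

(* Main.v *)
Require Import Defs.
From HB Require Import structures.
From mathcomp Require Import all_boot all_order all_algebra.
From mathcomp Require Import mpoly.
From mathcomp Require Import ring.
From Stdlib Require Import Classical ClassicalEpsilon FunctionalExtensionality.

(** Let A and A' be the Gram matrices of Q and Q', that is, q + q^T and q' + q'^T.
    As 2 is invertible, the two forms are equivalent when A and A' are congruent.
    The sum of A and -A is hyperbolic over [R].  Over the fraction field K, so is
    the sum B of A and -A', since A' is congruent to A there.  If B is hyperbolic
    over [R] already, then B is congruent to the sum of A and -A, and Witt
    cancellation gives the theorem.

    So consider the isometries from the split form H to B.  They have two possible
    determinants, and those with one fixed determinant [delta] form a principal
    bundle under SO(H), provided that [delta] is in [R].  The isometry over K has
    a determinant whose square is a unit of [R]; taking it for [delta], the bundle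
    has a point over K, and the Grothendieck-Serre conjecture provides one over
    [R].  Two facts take most of the work.

    First, [delta] is in [R], because a regular local ring is normal
    ([regular_root]).  The maximal ideal M is generated by as many elements
    x_1, ..., x_d as there are steps in some chain of primes.  Krull's principal
    ideal theorem ([principal_ideal_theorem]) shows that adjoining one element to
    an ideal shortens the chains above it by at most one ([chain_to_adjoin]), and
    it follows that all the ideals (x_1, ..., x_i) are prime ([regular_prime]).
    A square root of a unit is then lifted from the residue field, one x_i after
    the other, by Newton's iteration and Krull's intersection theorem
    ([root_divides_lift]).

    Second, the algebra E of these isometries is faithfully flat.  It is faithful
    because it has a point in an algebra of which [R] is a direct summand:
    diagonalise B and H, and adjoin to [R] square roots of the ratios of their
    entries ([sqrts_retraction]).  For flatness, E is a retract of a
    larger algebra ([flat_retract]): that of all matrices, a polynomial ring, in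
    which one adjoins, column by column, inverse square roots of the norms that
    come up in the Gram-Schmidt process.  An isometry yields a point of this
    algebra, with all the roots equal to 1; conversely, Gram-Schmidt turns every
    point into an isometry and fixes the isometries ([gram_schmidt]).  Each step
    replaces a flat algebra A by A[X] / (1 - n X^2), and this preserves flatness
    because an element of the tensor product of this algebra with a module
    vanishes if and only if its expansion in power series has finitely many
    nonzero coefficients ([flat_sqrt_algebra]). *)

Set Implicit Arguments.
Unset Strict Implicit.
Unset Printing Implicit Defensive.

Import GRing.Theory.
Local Open Scope ring_scope.

(** * Noetherian rings and the principal ideal theorem *)

(** Ideals are handled as [Prop]-valued predicates, which are closed under the
    quantifiers met below; excluded middle turns them into the boolean predicates
    over which [noetherian] quantifies. *)
Definition pred_of (T : Type) (P : T -> Prop) : {pred T} :=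
  fun x => if excluded_middle_informative (P x) then true else false.

Lemma pred_ofP (T : Type) (P : T -> Prop) x : reflect (P x) (x \in pred_of P).
Proof. by rewrite unfold_in /pred_of; case: excluded_middle_informative; constructor. Qed.

Section Ideals.
Variable R : comNzRingType.
Implicit Types (I J P Q : R -> Prop) (F : (R -> Prop) -> Prop).

Definition is_ideal I := I 0 /\ forall a x y, I x -> I y -> I (a * x + y).

Definition below I J := forall x, I x -> J x.

Definition is_prime P :=
  [/\ is_ideal P, ~ P 1 & forall x y, P (x * y) -> P x \/ P y].

Definition adjoin I x : R -> Prop := fun y => exists c, I (y - c * x).

(** The preimage of the extension of [I] to the local ring at [P]. *)
Definition saturation P I : R -> Prop := fun y => exists2 s, ~ P s & I (s * y).

Definition saturated P I := forall s y, ~ P s -> I (s * y) -> I y.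

Definition colon I u : R -> Prop := fun y => I (y * u).

Lemma idealD I x y : is_ideal I -> I x -> I y -> I (x + y).
Proof. by case=> _ h Ix Iy; rewrite -[x]mul1r; apply: h. Qed.

Lemma idealM I a x : is_ideal I -> I x -> I (a * x).
Proof. by case=> h0 h Ix; rewrite -[_ * _]addr0; apply: h. Qed.

Lemma idealB I x y : is_ideal I -> I x -> I y -> I (x - y).
Proof. by move=> h Ix Iy; apply: idealD => //; rewrite -mulN1r; apply: idealM. Qed.

Lemma ideal0 : is_ideal (fun x => x = 0).
Proof. by split=> // a x y -> ->; rewrite mulr0 addr0. Qed.

Lemma pred_of_ideal I : is_ideal I -> ~ I 1 -> idealr_closed (pred_of I).
Proof.
move=> [I0 ID] I1; split; [exact/pred_ofP | exact/pred_ofP |].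
by move=> a x y /pred_ofP Ix /pred_ofP Iy; apply/pred_ofP/ID.
Qed.

Lemma ideal_sum I k (c f : 'I_k -> R) :
  is_ideal I -> (forall i, I (f i)) -> I (\sum_i c i * f i).
Proof.
move=> hI If; elim/big_ind: _ => [|x y|i _]; [by case: hI | exact: idealD |].
exact: idealM.
Qed.

Lemma adjoin_ideal I x : is_ideal I -> is_ideal (adjoin I x).
Proof.
move=> hI; split; first by exists 0; rewrite mul0r subrr; case: hI.
move=> a y z [c Iy] [d Iz]; exists (a * c + d).
have -> : a * y + z - (a * c + d) * x = a * (y - c * x) + (z - d * x) by ring.
by apply: idealD => //; apply: idealM.
Qed.

Lemma below_adjoin I x : below I (adjoin I x).
Proof. by move=> y Iy; exists 0; rewrite mul0r subr0. Qed.

Lemma mem_adjoin I x : is_ideal I -> adjoin I x x.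
Proof. by move=> hI; exists 1; rewrite mul1r subrr; case: hI. Qed.

Lemma adjoin_below I J x : is_ideal J -> below I J -> J x -> below (adjoin I x) J.
Proof.
move=> hJ IJ Jx y [c Iy]; rewrite -[y](subrK (c * x)).
by apply: idealD => //; [apply: IJ | apply: idealM].
Qed.

Lemma colon_ideal I u : is_ideal I -> is_ideal (colon I u).
Proof.
move=> hI; split; first by rewrite /colon mul0r; case: hI.
move=> a x y Ix Iy; rewrite /colon mulrDl -mulrA.
by apply: idealD => //; apply: idealM.
Qed.

Lemma prime_mulN P s t : is_prime P -> ~ P s -> ~ P t -> ~ P (s * t).
Proof. by case=> _ _ h Ns Nt /h[]. Qed.

Lemma prime_exp P x k : is_prime P -> P (x ^+ k) -> P x.
Proof.
move=> hP; have [_ P1 hM] := hP; elim: k => [|k IHk]; first by rewrite expr0.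
by rewrite exprS => /hM[].
Qed.

Lemma saturation_ideal P I : is_prime P -> is_ideal I ->
  is_ideal (saturation P I).
Proof.
move=> hP hI; have [_ P1 _] := hP; split.
  by exists 1 => //; rewrite mulr0; case: hI.
move=> a x y [s Ps Ix] [t Pt Iy]; exists (s * t); first exact: prime_mulN.
have -> : s * t * (a * x + y) = (a * t) * (s * x) + s * (t * y) by ring.
by apply: idealD => //; apply: idealM.
Qed.

Lemma below_saturation P I : is_prime P -> below I (saturation P I).
Proof. by case=> _ P1 _ x Ix; exists 1; rewrite ?mul1r. Qed.

Lemma saturation_saturated P I : is_prime P -> saturated P (saturation P I).
Proof.
by move=> hP s y Ps [t Pt It]; exists (t * s); [exact: prime_mulN|rewrite -mulrA].
Qed.

Lemma saturation_below P I J : below I J -> saturated P J ->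
  below (saturation P I) J.
Proof. by move=> IJ satJ y [s Ps Iy]; apply: satJ Ps _; apply: IJ. Qed.

Section Noetherian.
Hypothesis noethR : noetherian R.

Lemma noetherian_generators I : is_ideal I ->
  exists k (f : 'I_k -> R), (forall i, I (f i)) /\
    forall x, I x -> exists c : 'I_k -> R, x = \sum_i c i * f i.
Proof.
move=> hI; have [I1|NI1] := classic (I 1).
  exists 1%N, (fun=> 1); split=> // x _; exists (fun=> x).
  by rewrite big_ord1 mulr1.
have [k [f hf]] := noethR (pred_of_ideal hI NI1).
exists k, f; split=> [i|x /pred_ofP/hf//].
apply/pred_ofP/hf; exists (fun j => (j == i)%:R).
rewrite (bigD1 i) //= eqxx mul1r big1 ?addr0 // => j /negPf ->.
by rewrite mul0r.
Qed.

(** An ascending chain of ideals stops at the stage that contains a finite set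
    of generators of its union, so a family without maximal member, from which
    one could extract a strictly ascending chain, is empty. *)
Lemma noetherian_maximal F : (forall I, F I -> is_ideal I) ->
  (exists I, F I) ->
  exists2 I, F I & forall J, F J -> below I J -> below J I.
Proof.
move=> Fid [I0 FI0]; apply: NNPP => Nmax.
have step (I : {I | F I}) :
    {J : {J | F J} | below (sval I) (sval J) /\ ~ below (sval J) (sval I)}.
  apply: constructive_indefinite_description.
  case: I => I FI /=; apply: NNPP => Nex; apply: Nmax; exists I => // J FJ IJ.
  by apply: NNPP => NJI; apply: Nex; exists (exist _ J FJ).
pose ch := fix ch n := if n is n'.+1 then sval (step (ch n')) else exist _ I0 FI0.
pose L n : R -> Prop := sval (ch n).
have Lid n : is_ideal (L n) by apply: Fid; apply: svalP.
have LS n : below (L n) (L n.+1) by case: (svalP (step (ch n))).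
have NLS n : ~ below (L n.+1) (L n) by case: (svalP (step (ch n))).
have Lle n m : (n <= m)%N -> below (L n) (L m).
  by move=> /subnK <-; elim: (m - n)%N => // k IHk x /IHk; rewrite addSn; apply: LS.
pose U x := exists n, L n x.
have Uid : is_ideal U.
  split; first by exists 0%N; case: (Lid 0%N).
  move=> a x y [n Lx] [m Ly]; exists (maxn n m).
  by case: (Lid (maxn n m)) => _; apply; [apply: (Lle n) | apply: (Lle m)];
    rewrite ?leq_maxl ?leq_maxr.
have [k [f [Uf genU]]] := noetherian_generators Uid.
have [N hN] : exists N, forall i, L N (f i).
  have [g hg] : exists g : 'I_k -> nat, forall i, L (g i) (f i).
    exists (fun i => sval (constructive_indefinite_description _ (Uf i))) => i.
    by case: constructive_indefinite_description.
  exists (\max_i g i) => i; apply: (Lle (g i)) (hg i).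
  exact: leq_bigmax.
apply: (NLS N) => x Lx.
have [|c ->] := genU x; first by exists N.+1.
exact: ideal_sum.
Qed.

(** Nakayama's lemma in the local ring at [P].  If the conclusion failed,
    enlarge [J] to a saturated ideal maximal among those not containing [I];
    some [x * z] with [z] in [I] is outside it, and adjoining [x * z] must
    capture [z], that is, [(s - c * x) * z] is in the enlarged ideal, where
    [s - c * x] is invertible at [P]. *)
Lemma nakayama_at P I J x : is_prime P -> P x -> is_ideal J -> saturated P J ->
  (forall y, I y -> exists2 s, ~ P s & exists2 z, I z & J (s * y - x * z)) ->
  below I J.
Proof.
move=> hP Px hJ satJ hI; apply: NNPP => NIJ.
pose F K := [/\ is_ideal K, saturated P K, below J K & ~ below I K].
have [||K [hK satK JK NIK] Kmax] := @noetherian_maximal F.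
- by move=> K [].
- by exists J; split.
have [z Iz Kz] : exists2 z, I z & ~ K (x * z).
  apply: NNPP => Nex; apply: NIK => y Iy.
  have [s Ps [z Iz Jz]] := hI y Iy; apply: (satK s) => //.
  rewrite -[_ * _](subrK (x * z)); apply: idealD => //; first exact: JK.
  by apply: NNPP => ?; apply: Nex; exists z.
pose K' := saturation P (adjoin K (x * z)).
have hK' : is_ideal K' by apply: saturation_ideal => //; apply: adjoin_ideal.
have KK' : below K K'.
  by move=> y Ky; apply: below_saturation => //; apply: below_adjoin.
have K'xz : K' (x * z) by apply: below_saturation => //; apply: mem_adjoin.
have [s Ps [c Kc]] : K' z.
  have [//|NK'z] := classic (K' z); case: Kz; apply: Kmax K'xz => //; split=> //.
  - exact: saturation_saturated.
  - by move=> y /JK /KK'.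
  - by move=> /(_ z Iz).
apply: Kz; apply: idealM => //; apply: (satK (s - c * x)); last first.
  by rewrite mulrBl -mulrA.
case: hP => hP _ _ Psx; apply: Ps; rewrite -[s](subrK (c * x)).
by apply: idealD => //; apply: idealM.
Qed.

Definition stationary (L : nat -> R -> Prop) :=
  exists n, forall m, (n <= m)%N -> below (L n) (L m).

(** The local ring at [P] modulo [A0] is Artinian when the elements of [P] are
    nilpotent in it.  Were there a counterexample, take [A] maximal such that
    some chain above [A] does not stop.  A minimal submodule above [A], spanned
    by an element [u] that [P] kills, either lies in all the terms of the chain
    or meets the late ones in [A] only. *)
Lemma artinian_at P A0 : is_prime P -> is_ideal A0 ->
  (forall z, P z -> exists2 s, ~ P s & exists k, A0 (s * z ^+ k)) ->
  forall L : nat -> R -> Prop,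
    (forall n, [/\ is_ideal (L n), saturated P (L n), below A0 (L n)
                 & below (L n.+1) (L n)]) -> stationary L.
Proof.
move=> hP hA0 nilp.
have [hPi P1 _] := hP.
pose chain A (L : nat -> R -> Prop) := forall n,
  [/\ is_ideal (L n), saturated P (L n), below A (L n) & below (L n.+1) (L n)].
suff H A : is_ideal A -> saturated P A -> below A0 A ->
    forall L, chain A L -> stationary L.
  move=> L hL; apply: (H (saturation P A0)).
  - exact: saturation_ideal.
  - exact: saturation_saturated.
  - exact: below_saturation.
  - by move=> n; have [? ? ? ?] := hL n; split=> //; apply: saturation_below.
move=> hA satA A0A L hL; apply: NNPP => Nst.
pose F B := [/\ is_ideal B, saturated P B, below A0 B &
  exists2 L, chain B L & ~ stationary L].
have [||{hA satA A0A Nst hL L}A' [hA satA A0A [L hL Nst]] Amax] :=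
  @noetherian_maximal F.
- by move=> B [].
- by exists A; split=> //; exists L.
move: A' hA satA A0A hL Amax => {}A hA satA A0A hL Amax.
apply: Nst.
have [A1|NA1] := classic (A 1).
  exists 0%N => m _ x _; have [hLm _ AL _] := hL m.
  by rewrite -[x]mulr1; apply: idealM => //; apply: AL.
have [||C [u Au CE] Cmax] :=
    @noetherian_maximal (fun C => exists2 u, ~ A u & C = colon A u).
- by move=> C [u _ ->]; apply: colon_ideal.
- by exists (colon A 1), 1.
have {C CE Cmax} Pu z : P z -> A (z * u).
  move=> Pz; have [s Ps [k Ak]] := nilp z Pz.
  have {s Ps Ak} Ak : A (z ^+ k) by apply: (satA s) => //; apply: A0A.
  (* multiply u by the last power of z that does not bring it into A *)
  have [j] : exists j, A (z ^+ j.+1 * u) /\ ~ A (z ^+ j * u).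
    have {Ak} : A (z ^+ k * u) by rewrite mulrC; apply: idealM.
    elim: k => [|k IHk]; first by rewrite mul1r.
    by have [/IHk//|? ?] := classic (A (z ^+ k * u)); exists k.
  rewrite exprS -mulrA => -[Aj NAj].
  rewrite -[A _]/(colon A u z) -CE; apply: Cmax (Aj : colon A (z ^+ j * u) z).
    by exists (z ^+ j * u).
  move=> y; rewrite CE /colon => Ay.
  by rewrite mulrCA; apply: idealM.
pose A' := saturation P (adjoin A u).
have hA' : is_ideal A' by apply: saturation_ideal => //; apply: adjoin_ideal.
have AA' : below A A'.
  by move=> y Ay; apply: below_saturation => //; apply: below_adjoin.
have A'u : A' u by apply: below_saturation => //; apply: mem_adjoin.
have DCC L' : chain A' L' -> stationary L'.
  move=> hL'; apply: NNPP => Nst; apply: Au; apply: Amax A'u => //.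
  split=> //; [exact: saturation_saturated | by move=> y /A0A /AA' |].
  by exists L'.
have Lle n m : (n <= m)%N -> below (L m) (L n).
  move=> /subnK <-; elim: (m - n)%N => // k IHk x; rewrite addSn => Lx.
  by apply: IHk; have [_ _ _] := hL (k + n)%N; apply.
have [Lu|] := classic (forall n, L n u).
  apply: DCC => n; have [hLn satL AL LS] := hL n; split=> //.
  by apply: saturation_below => //; apply: adjoin_below.
move=> /not_all_ex_not [n1 NLu].
have [|n0 hn0] := DCC (fun n => saturation P (adjoin (L n) u)).
  move=> n; have [hLn satL AL LS] := hL n; split.
  - by apply: saturation_ideal => //; apply: adjoin_ideal.
  - exact: saturation_saturated.
  - by move=> y [s Ps [c Ac]]; exists s => //; exists c; apply: AL.
  - by move=> y [s Ps [c Ac]]; exists s => //; exists c; apply: LS.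
exists (maxn n0 n1) => m; rewrite geq_max => /andP[n0m n1m] r Lr.
have [hLm satLm ALm _] := hL m.
have [s Ps [c Lc]] : saturation P (adjoin (L m) u) r.
  apply: hn0 => //; apply: below_saturation => //; apply: below_adjoin.
  by apply: Lle Lr; rewrite leq_maxl.
apply: (satLm s) => //; rewrite -[s * r](subrK (c * u)).
apply: idealD => //; apply: ALm; apply: Pu.
apply: NNPP => Pc; apply: NLu.
have [hL1 satL1 _ _] := hL n1; apply: (satL1 c) => //.
have -> : c * u = s * r - (s * r - c * u) by ring.
apply: idealB => //; last exact: Lle Lc.
by apply: idealM => //; apply: Lle Lr; rewrite leq_maxr.
Qed.

(** Otherwise the elements of [P] are nilpotent modulo [Q + (x)] at [P].  For
    [y] in [P1] outside [Q], let [J n] be the preimage of [Q + (y ^+ n)] in the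
    localisation at [P] in which [x] is inverted too.  Modulo [x] these ideals
    become stationary, and as [x] acts injectively modulo [J n], Nakayama gives
    [J n = J n.+1].  So [y ^+ n] is in [J n.+1], which makes a multiple of [y]
    out of a power of [x] times an element outside [P], against [x] not being
    in [P1]. *)
Lemma principal_ideal_theorem Q P1 P x : is_prime Q -> is_prime P1 -> is_prime P ->
  below Q P1 -> ~ below P1 Q -> below P1 P -> P x -> ~ P1 x ->
  exists P', [/\ is_prime P', below Q P', P' x, below P' P & ~ below P P'].
Proof.
move=> hQ hP1 hP QP1 NP1Q P1P Px NP1x; apply: NNPP => Nex.
have [hQi NQ1 Qpr] := hQ; have [hPi NP_1 Ppr] := hP; have [hP1i NP1_1 P1pr] := hP1.
pose A0 := adjoin Q x.
have hA0 : is_ideal A0 by apply: adjoin_ideal.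
have nilp z : P z -> exists2 s, ~ P s & exists k, A0 (s * z ^+ k).
  move=> Pz; apply: NNPP => Nz.
  pose F I := [/\ is_ideal I, below A0 I & forall s k, ~ P s -> ~ I (s * z ^+ k)].
  have [||I [hI A0I avI] Imax] := @noetherian_maximal F.
  - by move=> I [].
  - exists A0; split=> // s k Ps Ak; apply: Nz; exists s => //; by exists k.
  have meets a : ~ I a -> exists s k, ~ P s /\ adjoin I a (s * z ^+ k).
    move=> Ia; apply: NNPP => N; apply: Ia; apply: (Imax (adjoin I a)).
    - split=> [|y /A0I|s k Ps Ak]; [exact: adjoin_ideal | exact: below_adjoin |].
      by apply: N; exists s, k.
    - exact: below_adjoin.
    - exact: mem_adjoin.
  apply: Nex; exists I; split.
  - split=> // [I1|a b Iab].
      by apply: (avI 1 0%N) => //; rewrite mul1r.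
    apply: NNPP => /not_or_and[/meets[s [k [Ps [c Ic]]]] /meets[t [l [Pt [d Id]]]]].
    apply: (avI (s * t) (k + l)%N); first exact: prime_mulN.
    have -> : s * t * z ^+ (k + l) = (t * z ^+ l) * (s * z ^+ k - c * a)
        + (c * a) * (t * z ^+ l - d * b) + (c * d) * (a * b) by rewrite exprD; ring.
    by apply: idealD; [|apply: idealD|]; rewrite //; apply: idealM.
  - by move=> y Qy; apply: A0I; apply: below_adjoin.
  - by apply: A0I; apply: mem_adjoin.
  - move=> y Iy; apply: NNPP => Py; apply: (avI y 0%N Py).
    by rewrite mulr1.
  - move=> /(_ z Pz) Iz; apply: (avI 1 1%N) => //.
    by rewrite mul1r.
have [y P1y NQy] : exists2 y, P1 y & ~ Q y.
  by apply: NNPP => N; apply: NP1Q => y ?; apply: NNPP => ?; apply: N; exists y.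
pose J n r := exists2 s, ~ P s & exists j, adjoin Q (y ^+ n) (s * x ^+ j * r).
have hJ n : is_ideal (J n).
  have hA := adjoin_ideal (y ^+ n) hQi; split.
    by exists 1 => //; exists 0%N; rewrite mulr0; case: hA.
  move=> a r r' [s Ps [j Jr]] [s' Ps' [j' Jr']].
  exists (s * s'); first exact: prime_mulN.
  exists (j + j')%N; have -> : s * s' * x ^+ (j + j') * (a * r + r') =
     (a * s' * x ^+ j') * (s * x ^+ j * r) + (s * x ^+ j) * (s' * x ^+ j' * r').
    by rewrite exprD; ring.
  by apply: idealD => //; apply: idealM.
have satJ n : saturated P (J n).
  move=> t r Pt [s Ps [j Jr]]; exists (s * t); first exact: prime_mulN.
  by exists j; move: Jr; congr adjoin; ring.
have JS n : below (J n.+1) (J n).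
  move=> r [s Ps [j [c Qc]]]; exists s => //; exists j, (c * y).
  by move: Qc; rewrite exprS mulrA.
have Jx n r : J n (r * x) -> J n r.
  move=> [s Ps [j Jr]]; exists s => //; exists j.+1.
  by move: Jr; congr adjoin; rewrite exprS; ring.
have [|n hn] := artinian_at hP hA0 nilp (L := fun n => saturation P (adjoin (J n) x)).
  move=> n; split.
  - by apply: saturation_ideal => //; apply: adjoin_ideal.
  - exact: saturation_saturated.
  - move=> r [c Qc]; apply: below_saturation => //; exists c.
    by exists 1 => //; exists 0%N; apply: below_adjoin; rewrite !mul1r.
  - by move=> r [s Ps [c Jc]]; exists s => //; exists c; apply: JS.
have JJ : below (J n) (J n.+1).
  apply: (nakayama_at hP Px) => // r Jr.
  have [s Ps [c Jc]] : saturation P (adjoin (J n.+1) x) r.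
    by apply: hn => //; apply: below_saturation => //; apply: below_adjoin.
  exists s => //; exists c; last by rewrite (mulrC x).
  apply: Jx; have -> : c * x = s * r - (s * r - c * x) by ring.
  by apply: idealB => //; [apply: idealM | apply: JS].
have [s Ps [j [c Qc]]] : J n.+1 (y ^+ n).
  apply: JJ; exists 1 => //; exists 0%N; rewrite !mul1r.
  exact: mem_adjoin.
have {}Qc : Q (y ^+ n * (s * x ^+ j - c * y)).
  by move: Qc; congr Q; rewrite exprS; ring.
have {Qc} : P1 (s * x ^+ j).
  rewrite -[_ * _](subrK (c * y)); apply: idealD => //; last exact: idealM.
  by apply: QP1; case: (Qpr _ _ Qc) => // /(prime_exp hQ).
by case/P1pr => [/P1P//|/(prime_exp hP1)].
Qed.

(** Chains of primes above [I] are recorded by their length and their top, where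
    they are extended and where the principal ideal theorem acts on them. *)
Inductive chain_to I : nat -> (R -> Prop) -> Prop :=
| Chain0 P : is_prime P -> below I P -> chain_to I 0 P
| ChainS e P P' : chain_to I e P -> is_prime P' -> below P P' -> ~ below P' P ->
    chain_to I e.+1 P'.

Lemma chain_to_prime I e P : chain_to I e P -> is_prime P.
Proof. by case. Qed.

Lemma chain_to_below I e P : chain_to I e P -> below I P.
Proof. by elim=> // {}e Q P' _ IH _ QP' _ x /IH /QP'. Qed.

Lemma chain_to_base I e P : chain_to I e P ->
  exists P0, [/\ is_prime P0, below I P0 & chain_to P0 e P].
Proof.
elim=> [{}P hP IP|{}e Q P' _ [P0 [hP0 IP0 ch]] hP' QP' NP'Q].
  by exists P; split=> //; apply: Chain0.
by exists P0; split=> //; apply: ChainS ch _ _ _.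
Qed.

Lemma chain_to_sub I J e P : below J I -> chain_to I e P -> chain_to J e P.
Proof.
move=> JI; elim=> [{}P hP IP|{}e Q P' _ IH hP' QP' NP'Q].
  by apply: Chain0 => // x /JI /IP.
exact: ChainS IH _ _ _.
Qed.

(** Passing to the quotient by one element shortens a chain of primes by at most
    one: the principal ideal theorem lets one push the element down the chain,
    replacing one prime at a time. *)
Lemma chain_to_adjoin I e P x : is_ideal I -> chain_to I e.+1 P -> P x ->
  chain_to (adjoin I x) e P.
Proof.
move=> hI; elim: e P => [|e IHe] P hch Px; inversion_clear hch as [|? P1 ? ch hP P1P NPP1].
  apply: Chain0 => //; have [? _ _] := hP; apply: adjoin_below => //.
  by move=> y Iy; apply: P1P; apply: (chain_to_below ch).
have [P1x|NP1x] := classic (P1 x); first by apply: ChainS (IHe _ ch P1x) _ _ _.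
have hP1 := chain_to_prime ch.
inversion_clear ch as [|? Q ? chQ _ QP1 NP1Q].
have [P' [hP' QP' P'x P'P NPP']] :=
  principal_ideal_theorem (chain_to_prime chQ) hP1 hP QP1 NP1Q P1P Px NP1x.
apply: ChainS (IHe P' _ P'x) _ _ _ => //; apply: ChainS chQ _ _ _ => //.
by move=> P'Q; apply: NP1x; apply: QP1; apply: P'Q.
Qed.

End Noetherian.
End Ideals.

(** * Square roots of units in a regular local ring *)

Section RegularLocal.
Variables (R : comUnitRingType) (M : R -> Prop).
Implicit Types (I J P : R -> Prop) (s : seq R).
Hypothesis noethR : noetherian R.
Hypothesis primeM : is_prime M.
Hypothesis unitM : forall x, ~ M x -> x \is a GRing.unit.

Fixpoint adjoin_seq I s : R -> Prop :=
  if s is x :: s' then adjoin_seq (adjoin I x) s' else I.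

Lemma below_adjoin_seq I s : below I (adjoin_seq I s).
Proof.
elim: s I => [I y //|x s IHs I y Iy].
by apply: IHs; apply: below_adjoin.
Qed.

Lemma adjoin_seq_mono I J s : below I J -> below (adjoin_seq I s) (adjoin_seq J s).
Proof.
elim: s I J => [//|x s IHs] I J IJ; apply: IHs => y [c Iy].
by exists c; apply: IJ.
Qed.

Lemma adjoin_seq_ideal I s : is_ideal I -> is_ideal (adjoin_seq I s).
Proof. by elim: s I => // x s IHs I hI; apply: IHs; apply: adjoin_ideal. Qed.

Lemma mem_adjoin_seq I s x : is_ideal I -> x \in s -> adjoin_seq I s x.
Proof.
elim: s I => // y s IHs I hI; rewrite inE => /predU1P[->|xs] /=.
  by apply: below_adjoin_seq; apply: mem_adjoin.
by apply: IHs xs; apply: adjoin_ideal.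
Qed.

Lemma unitM_not x : x \is a GRing.unit -> ~ M x.
Proof.
have [hM M1 _] := primeM.
by move=> Ux Mx; apply: M1; rewrite -(mulVr Ux); apply: idealM.
Qed.

Lemma proper_below_M I : is_ideal I -> ~ I 1 -> below I M.
Proof.
move=> hI I1 x Ix; apply: NNPP => /unitM Ux; apply: I1.
by rewrite -(mulVr Ux); apply: idealM.
Qed.

Lemma chain_to_M I e P : chain_to I e.+1 P -> chain_to I e.+1 M.
Proof.
move=> h; inversion_clear h as [|? Q ? ch [hP P1 _] QP NPQ].
have PM := proper_below_M hP P1.
by apply: ChainS ch _ _ _ => // [x /QP /PM|MQ] //; apply: NPQ => x /PM /MQ.
Qed.

(** Each element of [s] shortens a chain by at most one, and a chain above [M]
    itself has length 0. *)
Lemma height_bound I s e P : is_ideal I -> (forall x, x \in s -> M x) ->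
  below M (adjoin_seq I s) -> chain_to I e P -> (e <= size s)%N.
Proof.
elim: s I e P => [|x s IHs] I e P hI sM /= MI ch.
  inversion_clear ch as [|e' Q ? chQ [hP P1 _] QP NPQ] => //; case: NPQ => y Py.
  by apply: (chain_to_below chQ); apply: MI; apply: proper_below_M Py.
case: e ch => [//|e] /chain_to_M ch; rewrite ltnS.
apply: (IHs (adjoin I x) e M) => //; first exact: adjoin_ideal.
  by move=> y ys; apply: sM; rewrite inE ys orbT.
by apply: chain_to_adjoin => //; apply: sM; rewrite inE eqxx.
Qed.

(** By induction both [I + (x)] and [P0 + (x)] are prime, where the given chain
    starts at [P0].  The height bound excludes that [x] is in [P0], and that the
    two differ.  Then [P0 = I + x P0], so [P0 = I]. *)
Lemma regular_prime I s P : is_ideal I -> (forall x, x \in s -> M x) ->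
  below M (adjoin_seq I s) -> chain_to I (size s) P -> is_prime I.
Proof.
have [hM M1 Mpr] := primeM.
elim: s I P => [|x s IHs] I P hI sM MI ch.
  have PM : below P M.
    by have [hP P1 _] := chain_to_prime ch; apply: proper_below_M.
  have IM : below I M by move=> y /(chain_to_below ch) /PM.
  by split=> // [/IM//|y z /IM /Mpr [] /MI]; [left|right].
have Mx : M x by apply: sM; rewrite inE eqxx.
have sM' y : y \in s -> M y by move=> ys; apply: sM; rewrite inE ys orbT.
have {}ch := chain_to_M ch.
have [P0 [hP0 IP0 ch0]] := chain_to_base ch.
have [hP0i _ P0pr] := hP0.
have hIx : is_ideal (adjoin I x) by apply: adjoin_ideal.
have hP0x : is_ideal (adjoin P0 x) by apply: adjoin_ideal.
have bound Q : chain_to (adjoin I x) (size s).+1 Q -> False.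
  by move=> /(height_bound hIx sM' MI); rewrite ltnn.
have IxP0x : below (adjoin I x) (adjoin P0 x).
  by move=> y [c Iy]; exists c; apply: IP0.
have adjM : below M (adjoin_seq (adjoin P0 x) s).
  by move=> y /MI; apply: adjoin_seq_mono.
have NP0x : ~ P0 x.
  by move=> P0x; apply: (bound M); apply: chain_to_sub ch0; apply: adjoin_below.
have prIx : is_prime (adjoin I x).
  apply: (IHs _ M) => //.
  exact: chain_to_adjoin.
have chP0x : chain_to (adjoin P0 x) (size s) M by apply: chain_to_adjoin.
have prP0x : is_prime (adjoin P0 x) by apply: (IHs _ M).
have P0Ix : below (adjoin P0 x) (adjoin I x).
  apply: NNPP => N.
  suff up e Q : chain_to (adjoin P0 x) e Q -> chain_to (adjoin I x) e.+1 Q.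
    exact: bound (up _ _ chP0x).
  elim=> [{}Q hQ PQ|{}e {}Q Q' _ IH hQ' QQ' NQ'Q]; last exact: ChainS IH _ _ _.
  apply: ChainS (Chain0 prIx _) _ _ _ => // [y /IxP0x/PQ//|QI].
  by apply: N => y /PQ /QI.
have P0I : below P0 I.
  apply: (nakayama_at noethR primeM Mx) => // [s' y /unitM Us Iy|y P0y].
    by rewrite -[y](mulKr Us); apply: idealM.
  have [c Iy] : adjoin I x y by apply: P0Ix; apply: below_adjoin.
  exists 1 => //; exists c; last by rewrite mul1r mulrC.
  have : P0 (c * x).
    have -> : c * x = y - (y - c * x) by ring.
    by apply: idealB => //; apply: IP0.
  by case/P0pr.
split=> // [/IP0 P01|y z /IP0/P0pr[]/P0I]; [|by left|by right].
by case: hP0.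
Qed.

(** Krull's intersection theorem for a principal ideal.  Once the ideals
    [J : x ^+ k] are stationary, an element of all the [J + (x ^+ k)] is, modulo
    [J], [x] times another such element, and Nakayama applies. *)
Lemma krull_intersection J x y : is_ideal J -> M x ->
  (forall k, adjoin J (x ^+ k) y) -> J y.
Proof.
move=> hJ Mx hy.
apply: (nakayama_at noethR primeM Mx hJ
          (I := fun y => forall k, adjoin J (x ^+ k) y)) => //.
  by move=> s z /unitM Us Jz; rewrite -[z](mulKr Us); apply: idealM.
have [||C [k0 ->] Cmax] :=
    @noetherian_maximal _ noethR (fun C => exists k, C = colon J (x ^+ k)).
- by move=> _ [k ->]; apply: colon_ideal.
- by exists (colon J (x ^+ 0)), 0%N.
have stat w : J (w * x ^+ k0.+1) -> J (w * x ^+ k0).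
  apply: (Cmax (colon J (x ^+ k0.+1))); first by exists k0.+1.
  by move=> v Jv; rewrite /colon exprS mulrCA; apply: idealM.
move=> z hz; have [_ M1 _] := primeM.
have [t Jt] := hz k0.+1.
exists 1 => //; exists (t * x ^+ k0); last by move: Jt; congr J; rewrite exprS; ring.
move=> k; have [t' Jt'] := hz (k0.+1 + k)%N.
exists (t' * x ^+ k0).
suff : J ((t - t' * x ^+ k) * x ^+ k0) by congr J; ring.
apply: stat.
have -> : (t - t' * x ^+ k) * x ^+ k0.+1 =
  (z - t' * x ^+ (k0.+1 + k)) - (z - t * x ^+ k0.+1) by rewrite exprD; ring.
exact: idealB.
Qed.

Section SquareRoot.
Variable u : R.
Hypotheses (unit2 : (2%:R : R) \is a GRing.unit) (unitu : u \is a GRing.unit).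

(** In the fraction field of the quotient by a prime [I], [a / b] is a square root
    of [u]; it should lie in that quotient. *)
Definition root_divides I :=
  forall a b, I (a ^+ 2 - u * b ^+ 2) -> adjoin I b a.

(** If [b] is not in [I + (x)], Newton's iteration for a square root [r] of [u]
    lifts the congruence [a = r b] from [I + (x)] to all [I + (x ^+ k)]; Krull's
    intersection theorem concludes.  In general divide [a] and [b] by a power
    of [x] first. *)
Lemma root_divides_lift I x : is_prime I -> is_prime (adjoin I x) -> M x ->
  root_divides (adjoin I x) -> root_divides I.
Proof.
move=> hI hIx Mx root_Ix.
have [hIi I1 Ipr] := hI; have [hIxi Ix1 Ixpr] := hIx.
have [hM M1 _] := primeM.
have [Ix|NIx] := classic (I x).
  move=> a b Iab; have [|c Ic] := root_Ix a b; first exact: below_adjoin.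
  by exists c; apply: (adjoin_below hIi (fun _ => id) Ix).
have IxM : below (adjoin I x) M by apply: proper_below_M.
have cancel k y : I (x ^+ k * y) -> I y by case/Ipr => // /(prime_exp hI).
have main a b : ~ adjoin I x b -> I (a ^+ 2 - u * b ^+ 2) -> adjoin I b a.
  move=> Nb Iab.
  have divide k c : adjoin I (x ^+ k) (c * b ^+ 2) -> adjoin I (x ^+ k) c.
    elim: k c => [|k IHk] c; first by exists c; rewrite mulr1 subrr; case: hIi.
    rewrite exprS => -[d Id].
    have [c' Ic'] : adjoin I x c.
      have [||/(prime_exp hIx)] // := Ixpr c (b ^+ 2).
      by exists (d * x ^+ k); move: Id; congr I; ring.
    have [e Ie] : adjoin I (x ^+ k) c'.
      apply: IHk; exists d; apply: (cancel 1%N).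
      have -> : x ^+ 1 * (c' * b ^+ 2 - d * x ^+ k) =
        (c * b ^+ 2 - d * (x * x ^+ k)) - b ^+ 2 * (c - c' * x) by ring.
      by apply: idealB => //; apply: idealM.
    exists e; have -> : c - e * (x * x ^+ k) =
      (c - c' * x) + x * (c' - e * x ^+ k) by ring.
    by apply: idealD => //; apply: idealM.
  have newton k : exists r t, I (a - r * b - t * x ^+ k.+1).
    elim: k => [|k [r [t Ht]]].
      have [|r [t Ht]] := root_Ix a b; first exact: below_adjoin.
      by exists r, t; rewrite expr1.
    set X := x ^+ k.+1 in Ht.
    have Hb : I ((u - r ^+ 2) * b ^+ 2 - X * (2%:R * r * b * t + t ^+ 2 * X)).
      have -> : (u - r ^+ 2) * b ^+ 2 - X * (2%:R * r * b * t + t ^+ 2 * X) =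
        (a + r * b + t * X) * (a - r * b - t * X) - (a ^+ 2 - u * b ^+ 2) by ring.
      by apply: idealB => //; apply: idealM.
    have [v Hv] : adjoin I X (u - r ^+ 2).
      by apply: divide; exists (2%:R * r * b * t + t ^+ 2 * X); rewrite (mulrC _ X).
    have Ur : 2%:R * r \is a GRing.unit.
      rewrite unitrM unit2 /=; apply: unitM => Mr; apply: (unitM_not unitu).
      have -> : u = (u - r ^+ 2 - v * X) + v * X + r * r by ring.
      apply: idealD => //; last exact: idealM.
      apply: idealD => //; first by apply: IxM; apply: below_adjoin.
      by apply: idealM => //; rewrite /X exprSr; apply: idealM.
    have Hvb : I (v * b ^+ 2 - 2%:R * r * b * t - t ^+ 2 * X).
      apply: (cancel k.+1); rewrite -/X.
      have -> : X * (v * b ^+ 2 - 2%:R * r * b * t - t ^+ 2 * X) =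
        ((u - r ^+ 2) * b ^+ 2 - X * (2%:R * r * b * t + t ^+ 2 * X))
        - b ^+ 2 * (u - r ^+ 2 - v * X) by ring.
      by apply: idealB => //; apply: idealM.
    have [d Hd] : adjoin I x (v * b - 2%:R * r * t).
      have [||] // := Ixpr b (v * b - 2%:R * r * t).
      exists (t ^+ 2 * x ^+ k); move: Hvb; congr I; rewrite /X (exprS x); ring.
    (* with w the inverse of 2 r, t = w v b - w d x modulo I *)
    set w := (2%:R * r)^-1.
    have Hw : 2%:R * r * w = 1 by rewrite mulrV.
    exists (r + w * v * X), (- (w * d)).
    have -> : a - (r + w * v * X) * b - - (w * d) * x ^+ k.+2 =
       (a - r * b - t * X) - (w * X) * (v * b - 2%:R * r * t - d * x)
       + (1 - 2%:R * r * w) * (t * X) by rewrite /X !exprS; ring.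
    rewrite Hw subrr mul0r addr0.
    by apply: idealB => //; apply: idealM.
  apply: (krull_intersection (x := x)) => //; first exact: adjoin_ideal.
  case=> [|k]; first by exists a; rewrite mulr1 subrr; case: (adjoin_ideal b hIi).
  by have [r [t Ht]] := newton k; exists t, r; move: Ht; congr I; ring.
move=> a b Iab.
have [Ib|NIb] := classic (I b).
  apply: below_adjoin; apply: (prime_exp hI (k := 2)).
  have -> : a ^+ 2 = (a ^+ 2 - u * b ^+ 2) + (u * b) * b by ring.
  by apply: idealD => //; apply: idealM.
have [k] : exists k, ~ adjoin I (x ^+ k) b.
  by apply: not_all_ex_not => h; apply: NIb; apply: (krull_intersection (x := x)).
elim: k a b Iab {NIb} => [|k IHk] a b Iab.
  by case; exists b; rewrite mulr1 subrr; case: hIi.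
move=> Nb; have [[b' Hb]|] := classic (adjoin I x b); last by move/main; apply.
have [a' Ha] : adjoin I x a.
  apply: (prime_exp hIx (k := 2)); exists (u * b' * b).
  have -> : a ^+ 2 - u * b' * b * x = (a ^+ 2 - u * b ^+ 2) + (u * b) * (b - b' * x).
    by ring.
  by apply: idealD => //; apply: idealM.
have [||c Hc] := IHk a' b'.
- apply: (cancel 2).
  have -> : x ^+ 2 * (a' ^+ 2 - u * b' ^+ 2) = (a ^+ 2 - u * b ^+ 2)
     - (a + a' * x) * (a - a' * x) + (u * (b + b' * x)) * (b - b' * x) by ring.
  by apply: idealD; [|apply: idealB|]; rewrite //; apply: idealM.
- move=> [e He]; apply: Nb; exists e.
  have -> : b - e * x ^+ k.+1 = (b - b' * x) + x * (b' - e * x ^+ k).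
    by rewrite exprS; ring.
  by apply: idealD => //; apply: idealM.
exists c; have -> : a - c * b =
    (a - a' * x) + x * (a' - c * b') - c * (b - b' * x) by ring.
by apply: idealB; [|apply: idealD|]; rewrite //; apply: idealM.
Qed.

(** Adjoining the generators of [M] one after the other, all intermediate ideals
    are prime, and the property descends from the residue field to [I]. *)
Lemma regular_root_divides I s P : is_ideal I -> (forall x, x \in s -> M x) ->
  below M (adjoin_seq I s) -> chain_to I (size s) P -> root_divides I.
Proof.
elim: s I P => [|x s IHs] I P hI sM MI ch.
  have hIp := regular_prime hI sM MI ch; have [_ I1 Ipr] := hIp => a b Iab.
  have [Mb|/unitM Ub] := classic (M b).
    apply: below_adjoin; apply: (prime_exp hIp (k := 2)).
    have -> : a ^+ 2 = (a ^+ 2 - u * b ^+ 2) + (u * b) * b by ring.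
    by apply: idealD => //; apply: idealM => //; apply: MI.
  by exists (a / b); rewrite divrK // subrr; case: hI.
have Mx : M x by apply: sM; rewrite inE eqxx.
have sM' y : y \in s -> M y by move=> ys; apply: sM; rewrite inE ys orbT.
have hIx := adjoin_ideal x hI.
have ch' : chain_to (adjoin I x) (size s) M.
  by apply: chain_to_adjoin => //; apply: chain_to_M ch.
apply: (root_divides_lift (x := x)) => //; first exact: regular_prime hI sM MI ch.
  exact: (regular_prime hIx sM' MI ch').
exact: IHs ch'.
Qed.

End SquareRoot.
End RegularLocal.

Section RegularLocalRing.
Variable R : comUnitRingType.
Hypothesis regR : regular_local R.

Lemma regular_local_data : exists (M : R -> Prop) (s : seq R),
  [/\ noetherian R, is_prime M, forall x, ~ M x -> x \is a GRing.unit &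
   [/\ forall x, x \in s -> M x, below M (adjoin_seq (fun x => x = 0) s) &
       exists P, chain_to (fun x : R => x = 0) (size s) P]].
Proof.
have [noethR [m [d [[[hm mmax] muniq] [[P [Ppr Pch]] _] [f hf]]]]] := regR.
have [m0 m1 mD] := hm.
have hM : is_ideal (fun x => x \in m) by split=> // a x y; apply: mD.
have h0 := ideal0 R.
have unitM x : ~ x \in m -> x \is a GRing.unit.
  move=> Nx; apply: NNPP => Ux; apply: Nx.
  pose F (I : R -> Prop) := [/\ is_ideal I, ~ I 1 & I x].
  have [||I [hI I1 Ix] Imax] := noetherian_maximal noethR (F := F).
  - by move=> I [].
  - exists (adjoin (fun x => x = 0) x); split; [exact: adjoin_ideal| |exact: mem_adjoin].
    move=> [c /eqP]; rewrite subr_eq0 => /eqP Ec; case: Ux.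
    by apply/unitrP; exists c; rewrite (mulrC x) -Ec.
  rewrite -(muniq (pred_of I)); first exact/pred_ofP.
  split=> [|J [J0 J1 JD] IJ y]; first exact: pred_of_ideal.
  apply/idP/idP; last exact: IJ.
  move=> Jy; apply/pred_ofP; apply: (Imax (fun z => z \in J)) => //.
    by split; [split=> // a z t; apply: JD | apply/negP | apply/IJ/pred_ofP].
  by move=> z /pred_ofP /IJ.
have primeM : is_prime (fun x => x \in m).
  split=> // [|x y xy]; first exact/negP.
  apply: NNPP => /not_or_and[/unitM Ux /unitM Uy]; case/negP: m1.
  by rewrite -[1](mulVr (_ : x * y \is a GRing.unit)) ?unitrM ?Ux //; apply: idealM hM xy.
exists (fun x => x \in m), [seq f i | i <- enum 'I_d]; split=> //.
have fm i : f i \in m.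
  apply/hf; exists (fun j => (j == i)%:R).
  rewrite (bigD1 i) //= eqxx mul1r big1 ?addr0 // => j /negPf ->.
  by rewrite mul0r.
split.
- by move=> x /mapP[i _ ->].
- move=> x /hf[c ->]; apply: ideal_sum => [|i]; first exact: adjoin_seq_ideal.
  by apply: mem_adjoin_seq => //; apply: map_f; rewrite mem_enum.
have primeP i : is_prime (fun x => x \in P i).
  have [[P0 P1 PD] pr] := Ppr i; split; first by split=> // a x y; apply: PD.
    exact/negP.
  by move=> x y /pr/orP.
rewrite size_map size_enum_ord; exists (fun x => x \in P ord_max).
suff H e (le_e : (e < d.+1)%N) :
    chain_to (fun x : R => x = 0) e (fun x => x \in P (Ordinal le_e)).
  by have := H d (ltnSn d); rewrite (_ : Ordinal _ = ord_max) //; apply: val_inj.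
elim: e le_e => [|e IHe] le_e.
  by apply: Chain0 => // x ->; have [[[]]] := Ppr (Ordinal le_e).
have [sub [x [x1 x2]]] := Pch (Ordinal (ltnW le_e)) (Ordinal le_e) (ltnSn e).
apply: ChainS (IHe (ltnW le_e)) _ _ _ => // /(_ x x1).
by rewrite (negPf x2).
Qed.

(** An instance of the normality of regular local rings: a fraction whose square
    is a unit of [R] lies in [R]. *)
Lemma regular_root (u a b : R) : (2%:R : R) \is a GRing.unit -> u \is a GRing.unit ->
  a ^+ 2 = u * b ^+ 2 -> exists c, a = c * b.
Proof.
move=> U2 Uu Eab.
have [M [s [noethR hM uM [sM Ms [P ch]]]]] := regular_local_data.
have h0 := ideal0 R.
have [|c /eqP] := regular_root_divides noethR hM uM U2 Uu h0 sM Ms ch (a := a) (b := b).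
  by rewrite Eab subrr.
by rewrite subr_eq0 => /eqP ->; exists c.
Qed.

Lemma regular_local_addN (x y : R) : x + y \is a GRing.unit ->
  x \is a GRing.unit \/ y \is a GRing.unit.
Proof.
have [M [s [_ [hM M1 _] uM _]]] := regular_local_data => Uxy.
apply: NNPP => /not_or_and[Ux Uy]; apply: M1; rewrite -(mulVr Uxy).
apply: idealM => //; apply: idealD => //; apply: NNPP => /uM //.
Qed.

End RegularLocalRing.

(** * Quotient algebras *)

Lemma lrmorphism_of (R : comNzRingType) (A B : comAlgType R) (f : A -> B) :
  zmod_morphism f -> monoid_morphism f -> scalable f ->
  exists F : {lrmorphism A -> B}, F =1 f.
Proof.
move=> fB fM fZ.
pose hB := GRing.isZmodMorphism.Build A B f fB.
pose hM := GRing.isMonoidMorphism.Build A B f fM.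
pose hZ := GRing.isScalable.Build R A B *:%R f fZ.
pose F : {lrmorphism A -> B} := HB.pack f hB hM hZ.
by exists F.
Qed.

Lemma lrmorph_alg (R : comNzRingType) (A B : comAlgType R)
    (f : {lrmorphism A -> B}) r : f r%:A = r%:A.
Proof. by rewrite linearZ rmorph1. Qed.

(** The structure map [rho] only serves to attach an [R]-algebra structure to the
    quotient, so [C] may be an algebra over another ring, such as [{poly A}]. *)
Definition quotient_algebra (R C : comNzRingType) (rho : {rmorphism R -> C})
  (I : idealr C) : Type := {ideal_quot I}.

Section QuotientAlgebra.
Variables (R C : comNzRingType) (rho : {rmorphism R -> C}) (I : idealr C).
Local Notation A := (quotient_algebra rho I).

HB.instance Definition _ := GRing.ComNzRing.on A.

Let pi (c : C) : A := \pi_({ideal_quot I})%qT c.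

Let pi_zmod : zmod_morphism pi.
Proof. exact: (rmorphB \pi_({ideal_quot I})%qT). Qed.
Let pi_monoid : monoid_morphism pi.
Proof.
by split; [exact: (rmorph1 \pi_({ideal_quot I})%qT)
          |exact: (rmorphM \pi_({ideal_quot I})%qT)].
Qed.
HB.instance Definition _ := GRing.isZmodMorphism.Build C A pi pi_zmod.
HB.instance Definition _ := GRing.isMonoidMorphism.Build C A pi pi_monoid.

Let scale (r : R) (x : A) : A := pi (rho r) * x.

Let scaleA a b x : scale a (scale b x) = scale (a * b) x.
Proof. by rewrite /scale !rmorphM mulrA. Qed.
Let scale1 : left_id 1 scale.
Proof. by move=> x; rewrite /scale !rmorph1 mul1r. Qed.
Let scaleDr : right_distributive scale +%R.
Proof. by move=> a x y; rewrite /scale mulrDr. Qed.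
Let scaleDl x : {morph scale^~ x : a b / a + b}.
Proof. by move=> a b; rewrite /scale !rmorphD mulrDl. Qed.
HB.instance Definition _ :=
  GRing.Zmodule_isLmodule.Build R A scaleA scale1 scaleDr scaleDl.

Let scaleAl (a : R) (x y : A) : a *: (x * y) = (a *: x) * y.
Proof. exact: mulrA. Qed.
HB.instance Definition _ := GRing.Lmodule_isLalgebra.Build R A scaleAl.

Let scaleAr (a : R) (x y : A) : a *: (x * y) = x * (a *: y).
Proof. exact: mulrCA. Qed.
HB.instance Definition _ := GRing.Lalgebra_isAlgebra.Build R A scaleAr.

Lemma quotient_algebra_pi : exists (B : comAlgType R) (p : {rmorphism C -> B}),
  [/\ forall x, exists c, x = p c, forall c, p c = 0 <-> c \in I &
      forall r, p (rho r) = r%:A].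
Proof.
exists (A : comAlgType R), pi; split.
- by move=> x; exists (repr (x : {ideal_quot I})); apply/esym/reprK.
- move=> c; have := Quotient.idealrBE I c 0; rewrite subr0 => ->.
  by rewrite -(rmorph0 pi); split=> /eqP.
- by move=> r; rewrite -[r%:A]/(pi (rho r) * 1) mulr1.
Qed.

End QuotientAlgebra.

Lemma quotient_algebraP (R C : comNzRingType) (rho : {rmorphism R -> C})
    (I : C -> Prop) : is_ideal I -> ~ I 1 ->
  exists (A : comAlgType R) (p : {rmorphism C -> A}),
  [/\ forall x, exists c, x = p c, forall c, p c = 0 <-> I c &
      forall r, p (rho r) = r%:A].
Proof.
move=> hI I1.
pose K : idealr C :=
  HB.pack (pred_of I : C -> bool) (isIdealr.Build C _ (pred_of_ideal hI I1)).
have [A [p [surj ker alg]]] := quotient_algebra_pi rho K.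
by exists A, p; split=> // c; split=> [/ker/pred_ofP|/pred_ofP/ker].
Qed.

Lemma quotient_algebra_lift (R C : comNzRingType) (rho : {rmorphism R -> C})
    (A S : comAlgType R) (p : {rmorphism C -> A}) (f : {rmorphism C -> S}) :
  (forall x, exists c, x = p c) -> (forall r, p (rho r) = r%:A) ->
  (forall r, f (rho r) = r%:A) -> (forall c, p c = 0 -> f c = 0) ->
  exists F : {lrmorphism A -> S}, forall c, F (p c) = f c.
Proof.
move=> surj palg falg ker.
pose g x := f (sval (constructive_indefinite_description _ (surj x))).
have gE c : g (p c) = f c.
  rewrite /g; case: constructive_indefinite_description => c' /= /eqP.
  rewrite eq_sym -subr_eq0 -rmorphB => /eqP/ker/eqP.
  by rewrite rmorphB subr_eq0 => /eqP.
have gB : zmod_morphism g.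
  move=> x y; have [[c ->] [d ->]] := (surj x, surj y).
  by rewrite -rmorphB !gE rmorphB.
have gM : monoid_morphism g.
  split=> [|x y]; first by rewrite -(rmorph1 p) gE rmorph1.
  by have [[c ->] [d ->]] := (surj x, surj y); rewrite -rmorphM !gE rmorphM.
have gZ : scalable g.
  move=> r x; have [c ->] := surj x.
  by rewrite -mulr_algl -palg -rmorphM !gE rmorphM falg mulr_algl.
have [F FE] := lrmorphism_of gB gM gZ.
by exists F => c; rewrite FE.
Qed.

(** * Flatness *)

Section Bilinear.
Variables (R : comNzRingType) (M N P : lmodType R) (b : M -> N -> P).
Hypothesis hb : bilinear_map b.

Lemma bilinear0l y : b 0 y = 0.
Proof. by have := hb.1 y (-1) 0 0; rewrite scaler0 addr0 scaleN1r addNr. Qed.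

Lemma bilinear0r x : b x 0 = 0.
Proof. by have := hb.2 x (-1) 0 0; rewrite scaler0 addr0 scaleN1r addNr. Qed.

Lemma bilinearZl r x y : b (r *: x) y = r *: b x y.
Proof. by have := hb.1 y r x 0; rewrite !addr0 bilinear0l addr0. Qed.

Lemma bilinear_suml (I : Type) (s : seq I) (r : I -> R) (m : I -> M) y :
  b (\sum_(i <- s) r i *: m i) y = \sum_(i <- s) r i *: b (m i) y.
Proof.
elim: s => [|i s IHs]; first by rewrite !big_nil bilinear0l.
by rewrite !big_cons hb.1 IHs.
Qed.

Lemma bilinear_sumr (I : Type) (s : seq I) (r : I -> R) (n : I -> N) x :
  b x (\sum_(i <- s) r i *: n i) = \sum_(i <- s) r i *: b x (n i).
Proof.
elim: s => [|i s IHs]; first by rewrite !big_nil bilinear0r.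
by rewrite !big_cons hb.2 IHs.
Qed.

End Bilinear.

Section EventuallyLinear.
Variables (R : comNzRingType) (N A B : lmodType R) (E : nat -> B -> A).

Hypothesis E_linear : forall r x y, exists L, forall j, (L <= j)%N ->
  E j (r *: x + y) = r *: E j x + E j y.

Let value j (P : lmodType R) (b : N -> A -> P) (t : seq (N * B)) : P :=
  \sum_(p <- t) b p.1 (E j p.2).

Let germ_eq (s t : seq (N * B)) : Prop :=
  exists L, forall j, (L <= j)%N ->
  forall (P : lmodType R) (b : N -> A -> P), bilinear_map b ->
  value j b s = value j b t.

Let germ_eqb s t : bool :=
  if excluded_middle_informative (germ_eq s t) then true else false.

Let germ_eqP s t : reflect (germ_eq s t) (germ_eqb s t).
Proof. by rewrite /germ_eqb; case: excluded_middle_informative => h; constructor. Qed.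

Let germ_refl s : germ_eqb s s.
Proof. by apply/germ_eqP; exists 0%N. Qed.

Let germ_sym s t : germ_eqb s t = germ_eqb t s.
Proof.
by apply/germ_eqP/germ_eqP => -[L h]; exists L => j Lj P b hb; rewrite h.
Qed.

Let germ_trans : transitive germ_eqb.
Proof.
move=> t s u /germ_eqP[L h] /germ_eqP[L' h']; apply/germ_eqP.
exists (maxn L L') => j; rewrite geq_max => /andP[Lj L'j] P b hb.
by rewrite h // h'.
Qed.

Let germ_equiv : equiv_rel (seq (N * B)) :=
  EquivRel germ_eqb germ_refl germ_sym germ_trans.

Let germ := {eq_quot germ_equiv}%qT.
HB.instance Definition _ := Choice.on germ.

Let cls (t : seq (N * B)) : germ := \pi_(germ)%qT t.

Let cls_eq s t : germ_eq s t -> cls s = cls t.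
Proof. by move=> h; apply/eqP; rewrite eqmodE; apply/germ_eqP. Qed.

Let cls_inj s t : cls s = cls t -> germ_eq s t.
Proof. by move=> /eqP; rewrite eqmodE => /germ_eqP. Qed.

Let cls_surj (x : germ) : exists t, x = cls t.
Proof. by exists (repr x); rewrite /cls reprK. Qed.

Let scale_seq r (t : seq (N * B)) := [seq (r *: p.1, p.2) | p <- t].

Let add (x y : germ) : germ := cls (repr x ++ repr y).
Let scale r (x : germ) : germ := cls (scale_seq r (repr x)).

Let value_cat j (P : lmodType R) (b : N -> A -> P) s t :
  value j b (s ++ t) = value j b s + value j b t.
Proof. by rewrite /value big_cat. Qed.

Let value_scale j (P : lmodType R) (b : N -> A -> P) r t :
  bilinear_map b -> value j b (scale_seq r t) = r *: value j b t.
Proof.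
move=> hb; rewrite /value big_map scaler_sumr; apply: eq_bigr => p _ /=.
exact: bilinearZl.
Qed.

Let cls_repr t : germ_eq (repr (cls t)) t.
Proof. by apply: cls_inj; rewrite /cls reprK. Qed.

Let cls_add s t : add (cls s) (cls t) = cls (s ++ t).
Proof.
apply: cls_eq; have [[L h] [L' h']] := (cls_repr s, cls_repr t).
exists (maxn L L') => j; rewrite geq_max => /andP[Lj L'j] P b hb.
by rewrite !value_cat h // h'.
Qed.

Let cls_scale r t : scale r (cls t) = cls (scale_seq r t).
Proof.
apply: cls_eq; have [L h] := cls_repr t; exists L => j Lj P b hb.
by rewrite !value_scale // h.
Qed.

Let addA : associative add.
Proof.
move=> x y z; have [[s ->] [t ->] [u ->]] := And3 (cls_surj x) (cls_surj y) (cls_surj z).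
by rewrite !cls_add catA.
Qed.

Let addC : commutative add.
Proof.
move=> x y; have [[s ->] [t ->]] := (cls_surj x, cls_surj y).
rewrite !cls_add; apply: cls_eq; exists 0%N => j _ P b hb.
by rewrite !value_cat addrC.
Qed.

Let add0 : left_id (cls [::]) add.
Proof. by move=> x; have [s ->] := cls_surj x; rewrite cls_add. Qed.

Let addN : left_inverse (cls [::]) (scale (-1)) add.
Proof.
move=> x; have [s ->] := cls_surj x; rewrite cls_scale cls_add; apply: cls_eq.
exists 0%N => j _ P b hb.
by rewrite value_cat value_scale // scaleN1r addNr /value big_nil.
Qed.

HB.instance Definition _ := GRing.isZmodule.Build germ addA addC add0 addN.

Let addE (x y : germ) : x + y = add x y. Proof. by []. Qed.

Let scaleA a b x : scale a (scale b x) = scale (a * b) x.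
Proof.
have [s ->] := cls_surj x; rewrite !cls_scale; apply: cls_eq.
by exists 0%N => j _ P c hc; rewrite !value_scale // scalerA.
Qed.
Let scale1 : left_id 1 scale.
Proof.
move=> x; have [s ->] := cls_surj x; rewrite cls_scale; apply: cls_eq.
by exists 0%N => j _ P c hc; rewrite !value_scale // scale1r.
Qed.
Let scaleDr : right_distributive scale +%R.
Proof.
move=> a x y; have [[s ->] [t ->]] := (cls_surj x, cls_surj y).
rewrite !addE !(cls_add, cls_scale); apply: cls_eq.
by exists 0%N => j _ P c hc; rewrite !(value_cat, value_scale) // scalerDr.
Qed.
Let scaleDl x : {morph scale^~ x : a b / a + b}.
Proof.
move=> a b; have [s ->] := cls_surj x.
rewrite !addE !(cls_add, cls_scale); apply: cls_eq.
by exists 0%N => j _ P c hc; rewrite !(value_cat, value_scale) // scalerDl.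
Qed.
HB.instance Definition _ :=
  GRing.Zmodule_isLmodule.Build R germ scaleA scale1 scaleDr scaleDl.

(** The vanishing in [N (x) B] is tested on a module made to detect it: finite
    families of pairs, two of them being identified when their images under [E j]
    have the same tensor in [N (x) A] for all large [j]. *)
Lemma tensor_zero_eventually (t : seq (N * B)) : tensor_zero t ->
  exists L, forall j, (L <= j)%N -> tensor_zero [seq (p.1, E j p.2) | p <- t].
Proof.
move=> /(_ (germ : lmodType R) (fun n x => cls [:: (n, x)])) ht.
have /ht : bilinear_map (fun n x => cls [:: (n, x)] : (germ : lmodType R)).
  split=> [x r n n'|n r x y].
    rewrite -[RHS]/(add (scale _ _) _) cls_scale cls_add; apply: cls_eq.
    exists 0%N => j _ P b hb.
    by rewrite /value !big_cons !big_nil /= !addr0 hb.1 (bilinearZl hb).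
  have [L hL] := E_linear r x y.
  rewrite -[RHS]/(add (scale _ _) _) cls_scale cls_add; apply: cls_eq.
  exists L => j Lj P b hb.
  by rewrite /value !big_cons !big_nil /= !addr0 hL // hb.2 (bilinearZl hb).
have -> : \sum_(p <- t) (cls [:: (p.1, p.2)] : germ) = cls t.
  elim: t {ht} => [|p t IHt]; first by rewrite big_nil.
  by rewrite big_cons IHt -[LHS]/(add _ _) cls_add; case: p.
move=> /cls_inj[L hL]; exists L => j Lj P b hb.
by rewrite big_map -[LHS]/(value j b t) hL // /value big_nil.
Qed.

End EventuallyLinear.

Section Flatness.
Variable R : comNzRingType.

(** A tensor over a free module vanishes when its coordinates do. *)
Lemma flat_mpoly k : flat ({mpoly R[k]} : lmodType R).
Proof.
move=> M N f injf t ht P b hb.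
have coefs m : \sum_(p <- t) p.2@_m *: p.1 = 0.
  apply: injf; rewrite linear_sum linear0.
  have := ht N (fun n (q : {mpoly R[k]}) => q@_m *: n); rewrite big_map /= => h.
  rewrite -[RHS]h; first by apply: eq_bigr => p _; rewrite linearZ.
  split=> [q r n n'|n r q q']; first by rewrite scalerDr !scalerA mulrC.
  by rewrite mcoeffD mcoeffZ scalerDl scalerA.
pose d := \max_(p <- t) msize p.2.
rewrite big_seq (eq_bigr (fun p : M * {mpoly R[k]} =>
    \sum_(m : 'X_{1..k < d}) p.2@_m *: b p.1 'X_[m])); last first.
  move=> p pt; rewrite {1}(@mpolywE k R d p.2); last exact: leq_bigmax_seq.
  exact: (bilinear_sumr hb _ (fun m : 'X_{1..k < d} => p.2@_m)).
rewrite -big_seq exchange_big big1 // => m _.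
have h := bilinear_suml hb t (fun p => p.2@_m) (fun p => p.1) 'X_[m].
by rewrite -h coefs bilinear0l.
Qed.

Lemma tensor_zero_map (M A B : lmodType R) (f : {linear A -> B}) (t : seq (M * A)) :
  tensor_zero t -> tensor_zero [seq (p.1, f p.2) | p <- t].
Proof.
move=> ht P b [bl br]; rewrite big_map /=; apply: (ht P (fun m x => b m (f x))).
by split=> [x|m r x y]; [exact: bl | rewrite linearP br].
Qed.

Lemma flat_retract (A B : lmodType R) (f : {linear A -> B}) (g : {linear B -> A}) :
  cancel f g -> flat B -> flat A.
Proof.
move=> fK flatB M N h injh t ht.
have := tensor_zero_map f ht; rewrite -map_comp => htB.
have /(tensor_zero_map g) : tensor_zero [seq (p.1, f p.2) | p <- t].
  by apply: (flatB M N h injh); rewrite -map_comp.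
rewrite -map_comp; congr tensor_zero; rewrite -[RHS]map_id.
by apply: eq_map => -[m a] /=; rewrite fK.
Qed.

(** A linear form with value 1 at 1; it makes [R] a direct summand of [S]. *)
Definition unit_retraction (S : comAlgType R) (l : S -> R) :=
  (forall r x y, l (r *: x + y) = r * l x + l y) /\ l 1 = 1.

Lemma faithful_of_retraction (A S : comAlgType R) (x : {lrmorphism A -> S})
    (l : S -> R) (M : lmodType R) : unit_retraction l ->
  (forall t : seq (M * A), tensor_zero t) -> forall m : M, m = 0.
Proof.
move=> [lP l1] ht m.
have := ht [:: (m, 1)] M (fun m' a => l (x a) *: m').
rewrite big_cons big_nil /= addr0 rmorph1 l1 scale1r; apply.
split=> [a r m1 m2|m' r a a']; first by rewrite scalerDr !scalerA mulrC.
by rewrite linearP lP scalerDl scalerA.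
Qed.

End Flatness.

(** The coefficients of the power series f / (1 - n X^2). *)
Fixpoint expand (A : comNzRingType) (n : A) (f : nat -> A) (j : nat) : A :=
  match j with
  | j'.+2 => n * expand n f j' + f j
  | _ => f j
  end.

Section Expand.
Variables (A : comNzRingType) (n : A).

Lemma expand_linear a f g j :
  expand n (fun i => a * f i + g i) j = a * expand n f j + expand n g j.
Proof.
suff [] : expand n (fun i => a * f i + g i) j = a * expand n f j + expand n g j /\
  expand n (fun i => a * f i + g i) j.+1 = a * expand n f j.+1 + expand n g j.+1 by [].
by elim: j => [//|j [IH IHS]]; split=> //=; rewrite IH; ring.
Qed.

Local Notation D := (1 - n%:P * 'X^2 : {poly A}).

Lemma coef_den (q : {poly A}) j :
  (D * q)`_j = q`_j - (if j is j'.+2 then n * q`_j' else 0).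
Proof.
rewrite mulrBl mul1r -mulrA coefB coefCM coefXnM.
by case: j => [|[|j]] /=; rewrite ?mulr0 // !subSS subn0.
Qed.

Lemma expand_den (q : {poly A}) j : expand n (fun i => (D * q)`_i) j = q`_j.
Proof.
suff [] : expand n (fun i => (D * q)`_i) j = q`_j /\
  expand n (fun i => (D * q)`_i) j.+1 = q`_j.+1 by [].
elim: j => [|j [IH IHS]]; first by rewrite /= !coef_den !subr0.
by split=> //; rewrite /= IH coef_den; ring.
Qed.

(** From the degree of [f] on, the expansion satisfies the recurrence of the
    denominator; two consecutive coefficients carry all that remains of [f]. *)
Lemma expand_tail (f : {poly A}) L : (size f <= L)%N ->
  f - ((expand n (nth 0 f) L)%:P * 'X^L
       + (expand n (nth 0 f) L.+1)%:P * 'X^(L.+1))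
  = D * \poly_(j < L) expand n (nth 0 f) j.
Proof.
move=> sf; apply/polyP => j; rewrite coef_den coefB coefD !coefCM !coefXn !coef_poly.
set e := expand n (nth 0 f).
have eS i : e i.+2 = n * e i + f`_i.+2 by [].
have f0 i : (L <= i)%N -> f`_i = 0 by move=> Li; rewrite nth_default // (leq_trans sf).
case: (ltngtP j L) => [jL|Lj|->].
- rewrite (ltn_eqF (ltnW jL : (j < L.+1)%N)) !mulr0 addr0 subr0.
  case: j jL => [|[|j]] jL; rewrite ?subr0 //.
  by rewrite coef_poly (ltnW (ltnW jL)) eS; ring.
- rewrite mulr0 add0r f0 1?ltnW // sub0r.
  have [->|NjL] := eqVneq j L.+1.
    rewrite mulr1; case: (L) f0 => [|l] f0.
      by rewrite /e /= f0 // subrr oppr0.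
    by rewrite coef_poly ltnSn eS f0 ?addr0 ?sub0r.
  have {}Lj : (L.+1 < j)%N by rewrite ltn_neqAle eq_sym NjL.
  case: j Lj {NjL} => [|[|j]] // Lj.
  by rewrite coef_poly ltnNge (_ : (L <= j)%N) //= !mulr0 subrr oppr0.
- rewrite (ltn_eqF (ltnSn L)) mulr0 addr0 mulr1 f0 // sub0r sub0r.
  case: (L) f0 => [|[|l]] f0; rewrite ?subr0.
  + by rewrite /e /= f0.
  + by rewrite /e /= f0.
  by rewrite coef_poly eS f0 // addr0 leqnSn.
Qed.

End Expand.

(** In [A[X] / (1 - n X^2)], the element [n] has become the inverse of a square,
    for arbitrary [n]: this localises at [n] and adjoins a square root in one
    step. *)
Section SquareRootAlgebra.
Variables (R : comNzRingType) (A : comAlgType R) (n : A).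

Local Notation D := (1 - n%:P * 'X^2 : {poly A}).

Let rho : {rmorphism R -> {poly A}} := polyC \o in_alg A.

Lemma rho_mul r (f : {poly A}) : rho r * f = r%:A *: f.
Proof. by rewrite mul_polyC. Qed.

Lemma sqrt_algebra : ~ (exists q, 1 = D * q) ->
  exists (B : comAlgType R) (p : {rmorphism {poly A} -> B}),
  [/\ forall x, exists c, x = p c, forall c, p c = 0 <-> exists q, c = D * q &
      forall r, p (rho r) = r%:A].
Proof.
apply: quotient_algebraP; split; first by exists 0; rewrite mulr0.
by move=> a _ _ [q ->] [q' ->]; exists (a * q + q'); ring.
Qed.

(** An element of [N (x) A[X] / (1 - n X^2)] vanishes as soon as the
    coefficients of its expansion in power series, which lie in [N (x) A], vanish
    from some point on: it is then the tail of that expansion that represents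
    it. *)
Lemma flat_sqrt_algebra (B : comAlgType R) (p : {rmorphism {poly A} -> B}) :
  (forall x, exists c, x = p c) -> (forall c, p c = 0 <-> exists q, c = D * q) ->
  (forall r, p (rho r) = r%:A) -> flat A -> flat B.
Proof.
move=> surj ker palg flatA M N f injf t ht P b hb.
pose g x := sval (constructive_indefinite_description _ (surj x)).
have gK x : p (g x) = x by rewrite /g; case: constructive_indefinite_description.
pose E j x := expand n (nth 0 (g x)) j.
have pZ r c : p (r%:A *: c) = r *: p c.
  by rewrite -rho_mul rmorphM palg mulr_algl.
have E_lin r x y : exists L, forall j, (L <= j)%N ->
    E j (r *: x + y) = r *: E j x + E j y.
  have [q Hq] : exists q, g (r *: x + y) - (r%:A *: g x + g y) = D * q.
    by apply/ker; rewrite rmorphB rmorphD pZ !gK subrr.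
  exists (size q) => j Lj; rewrite -[RHS]add0r -[r *: E j x]mulr_algl /E -expand_linear.
  have h : expand n (fun i => (D * q)`_i) j = 0 by rewrite expand_den nth_default.
  rewrite -[X in _ = X + _]h.
  rewrite -Hq -[X in _ = X + _]mul1r -expand_linear.
  congr (expand n); apply: functional_extensionality => i.
  by rewrite mul1r coefB coefD coefZ /= subrK.
have [L hL] := tensor_zero_eventually E_lin ht.
have hM j : (L <= j)%N -> tensor_zero [seq (q.1, E j q.2) | q <- t].
  move=> /hL; rewrite -map_comp => h; apply: (flatA M N f injf).
  by rewrite -map_comp.
pose K := maxn L (\max_(q <- t) size (g q.2)).
have tail q : q \in t ->
    q.2 = p ((E K q.2)%:P * 'X^K) + p ((E K.+1 q.2)%:P * 'X^(K.+1)).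
  move=> qt; apply/eqP; rewrite -rmorphD -subr_eq0 -{1}[q.2]gK -rmorphB.
  apply/eqP/ker; eexists; apply: expand_tail.
  by apply: leq_trans (leq_maxr _ _); apply: (leq_bigmax_seq (F := fun q => size (g q.2))).
have bilin j : bilinear_map (fun m (a : A) => b m (p (a%:P * 'X^j))).
  split=> [a|m r a a']; first exact: hb.1.
  have -> : (r *: a + a')%:P * 'X^j = r%:A *: (a%:P * 'X^j) + a'%:P * 'X^j.
    by rewrite polyCD mulrDl -[r *: a]mulr_algl polyCM -[RHS]/(_ *: _ + _) -mul_polyC mulrA.
  by rewrite rmorphD pZ hb.2.
rewrite big_seq (eq_bigr (fun q : M * B =>
  b q.1 (p ((E K q.2)%:P * 'X^K)) + b q.1 (p ((E K.+1 q.2)%:P * 'X^(K.+1))))).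
  rewrite -big_seq big_split /=.
  have := hM K (leq_maxl _ _) P _ (bilin K); rewrite big_map /= => ->.
  have := hM K.+1 (leqW (leq_maxl _ _)) P _ (bilin K.+1); rewrite big_map /= => ->.
  by rewrite addr0.
move=> q qt; rewrite {1}(tail _ qt).
by have := hb.2 q.1 1; move=> h; rewrite -[X in b _ (X + _)]scale1r h scale1r.
Qed.

(** The given point with values in [S] makes the extension nonzero, and extends
    to it. *)
Lemma sqrt_extension (S : comAlgType R) (phi : {lrmorphism A -> S}) (w : S) :
  phi n * w ^+ 2 = 1 ->
  exists (B : comAlgType R) (iota : {lrmorphism A -> B}) (s : B)
         (psi : {lrmorphism B -> S}),
  [/\ flat A -> flat B, iota n * s ^+ 2 = 1, forall a, psi (iota a) = phi a &
      psi s = w].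
Proof.
move=> nw.
pose ev : {rmorphism {poly A} -> S} := horner_eval w \o map_poly phi.
have evE f : ev f = (map_poly phi f).[w] by [].
have evC a : ev a%:P = phi a by rewrite evE map_polyC hornerC.
have evX : ev 'X = w by rewrite evE map_polyX hornerX.
have evD q : ev (D * q) = 0.
  by rewrite rmorphM rmorphB rmorph1 rmorphM rmorphXn evC evX nw subrr mul0r.
have [|B [p [surj ker palg]]] := sqrt_algebra.
  by move=> [q /(congr1 ev)]; rewrite evD rmorph1 => /eqP; rewrite oner_eq0.
have [psi psiE] : exists F : {lrmorphism B -> S}, forall c, F (p c) = ev c.
  apply: (quotient_algebra_lift surj palg) => [r|c /ker[q ->]] //.
  by rewrite -[rho r]/(_%:P) evC lrmorph_alg.
have [|||iota iotaE] := @lrmorphism_of R A B (fun a => p a%:P).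
- by move=> a a'; rewrite polyCB rmorphB.
- by split=> [|a a']; rewrite ?polyC1 ?rmorph1 // polyCM rmorphM.
- by move=> r a; rewrite -mulr_algl polyCM rmorphM palg mulr_algl.
exists B, iota, (p 'X), psi; split.
- exact: flat_sqrt_algebra.
- have := (ker (D * 1)).2 (ex_intro _ 1 erefl).
  rewrite mulr1 rmorphB rmorph1 rmorphM rmorphXn -iotaE => /eqP.
  by rewrite subr_eq0 eq_sym => /eqP.
- by move=> a; rewrite iotaE psiE evC.
- by rewrite psiE evX.
Qed.

End SquareRootAlgebra.

(** Adjoining a square root of a unit [b] of [R] keeps [R] a direct summand; the
    retraction takes the even part of a polynomial and evaluates it at
    [X^2 = b]. *)
Lemma sqrt_retraction (R : comNzRingType) (A : comAlgType R) (a b : R) (l : A -> R) :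
  a * b = 1 -> unit_retraction l ->
  exists (B : comAlgType R) (iota : {lrmorphism A -> B}) (s : B) (l' : B -> R),
    a%:A * s ^+ 2 = 1 /\ unit_retraction l'.
Proof.
move=> ab [lP l1].
pose D : {poly A} := 1 - (a%:A)%:P * 'X^2.
pose Lam f := l (even_poly f).[b%:A].
have evenD q : (even_poly (D * q)).[b%:A] = 0.
  have -> : even_poly (D * q) = (1 - (a%:A)%:P * 'X) * even_poly q.
    apply/polyP => i; rewrite coef_even_poly coef_den mulrBl mul1r -mulrA coefB.
    rewrite coefCM coefXM !coef_even_poly; case: i => [|i] /=; rewrite ?mulr0 //.
  rewrite hornerM hornerD hornerN hornerM !hornerE.
  by rewrite -scalerAl mul1r scalerA ab scale1r subrr mul0r.
have LamP r f g : Lam (r%:A *: f + g) = r * Lam f + Lam g.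
  by rewrite /Lam even_polyD even_polyZ hornerD hornerZ mulr_algl lP.
have LamD q : Lam (D * q) = 0.
  rewrite /Lam evenD; have := lP (-1) 0 0.
  by rewrite scaler0 addr0 mulN1r addNr.
have Lam1 : Lam 1 = 1 by rewrite /Lam even_polyC hornerC l1.
have [|B [p [surj ker palg]]] := @sqrt_algebra R A a%:A.
  by move=> [q /(congr1 Lam)/eqP]; rewrite LamD Lam1 oner_eq0.
have [|||iota iotaE] := @lrmorphism_of R A B (fun a => p a%:P).
- by move=> c c'; rewrite polyCB rmorphB.
- by split=> [|c c']; rewrite ?polyC1 ?rmorph1 // polyCM rmorphM.
- by move=> r c; rewrite -mulr_algl polyCM rmorphM palg mulr_algl.
pose l' x := Lam (sval (constructive_indefinite_description _ (surj x))).
have l'E c : l' (p c) = Lam c.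
  rewrite /l'; case: constructive_indefinite_description => c' /= /eqP.
  rewrite eq_sym -subr_eq0 -rmorphB => /eqP/ker[q Eq].
  have := LamP 1 (D * q) c; rewrite !scale1r LamD mulr0 add0r => <-.
  by rewrite -[D * q]Eq subrK.
exists B, iota, (p 'X), l'; split.
  have := (ker (D * 1)).2 (ex_intro _ 1 erefl).
  rewrite mulr1 rmorphB rmorph1 rmorphM rmorphXn palg => /eqP.
  by rewrite subr_eq0 eq_sym => /eqP.
split=> [r x y|]; last by rewrite -(rmorph1 p) l'E Lam1.
have [[c ->] [d ->]] := (surj x, surj y).
by rewrite -mulr_algl -palg -rmorphM -rmorphD !l'E rho_mul LamP.
Qed.

Lemma sqrts_retraction (R : comNzRingType) k (a b : 'I_k -> R) :
  (forall i, a i * b i = 1) ->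
  exists (S : comAlgType R) (s : 'I_k -> S) (l : S -> R),
    (forall i, (a i)%:A * s i ^+ 2 = 1) /\ unit_retraction l.
Proof.
elim: k a b => [|k IHk] a b ab.
  exists (R^o : comAlgType R), (fun=> 0), id; split; first by case.
  by split.
have [S [s [l [Hs Hl]]]] := IHk (fun i => a (lift ord0 i)) _ (fun i => ab (lift ord0 i)).
have [B [iota [s0 [l' [Hs0 Hl']]]]] := sqrt_retraction (ab ord0) Hl.
exists B, (fun i => if unlift ord0 i is Some j then iota (s j) else s0), l'.
split=> // i; case: unliftP => [j ->|-> //].
by rewrite -(lrmorph_alg iota) -rmorphXn -rmorphM Hs rmorph1.
Qed.

(** * Quadratic forms and symmetric matrices *)

Section QuadraticForms.
Variables (S : comNzRingType) (n : nat).
Implicit Types (q g : 'M[S]_n).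

Definition gram q : 'M[S]_n := q + q^T.

Lemma gram_sym q : (gram q)^T = gram q.
Proof. by rewrite /gram linearD /= trmxK addrC. Qed.

Lemma gram_congr g q : gram (g^T *m q *m g) = g^T *m gram q *m g.
Proof. by rewrite /gram !trmx_mul trmxK mulmxDr mulmxDl mulmxA. Qed.

Lemma quadformE q : quadform q =
  \sum_i \sum_j (q i j)%:MP * ('X_i * 'X_j).
Proof. by apply: eq_bigr => i _; apply: eq_bigr => j _; rewrite mul_mpolyC. Qed.

Lemma quadformD q q' : quadform (q + q') = quadform q + quadform q'.
Proof.
rewrite /quadform -big_split; apply: eq_bigr => i _ /=.
by rewrite -big_split; apply: eq_bigr => j _ /=; rewrite mxE scalerDl.
Qed.

Lemma quadform_tr q : quadform q^T = quadform q.
Proof.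
rewrite /quadform exchange_big; apply: eq_bigr => i _; apply: eq_bigr => j _ /=.
by rewrite mxE mulrC.
Qed.

Lemma lin_subst_quadform g q : lin_subst g (quadform q) = quadform (g^T *m q *m g).
Proof.
have XE i : comp_mpoly [tuple \sum_j g i j *: 'X_j | i < n] 'X_i =
    \sum_j (g i j)%:MP * 'X_j :> {mpoly S[n]}.
  rewrite comp_mpolyXU -tnth_nth tnth_mktuple.
  by apply: eq_bigr => j _; rewrite mul_mpolyC.
rewrite /lin_subst !quadformE rmorph_sum /=.
under eq_bigr => i _.
  rewrite rmorph_sum /=.
  under eq_bigr => j _ do rewrite !rmorphM /= !XE comp_mpolyC mulr_suml mulr_sumr.
  over.
rewrite /=.
under [RHS]eq_bigr => k _.
  under eq_bigr => l _.
    rewrite mxE rmorph_sum mulr_suml /=.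
    under eq_bigr => j _.
      rewrite mxE mulr_suml rmorph_sum mulr_suml /=.
      under eq_bigr => i _ do rewrite mxE !rmorphM /=.
      over.
    over.
  over.
rewrite /=.
(* both sides are sums over i, j, k, l; move k and l outside on the left *)
transitivity (\sum_k \sum_l \sum_j \sum_i
    (q i j)%:MP * ((g i k)%:MP * 'X_k * ((g j l)%:MP * 'X_l)) : {mpoly S[n]}).
  under eq_bigr => i _.
    under eq_bigr => j _.
      under eq_bigr => k _ do rewrite !mulr_sumr.
      rewrite /=; over.
    rewrite exchange_big /=.
    under eq_bigr => k _ do rewrite exchange_big /=.
    over.
  rewrite exchange_big /=; apply: eq_bigr => k _.
  by rewrite exchange_big /=; apply: eq_bigr => l _; rewrite exchange_big.
apply: eq_bigr => k _; apply: eq_bigr => l _; apply: eq_bigr => j _.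
by apply: eq_bigr => i _; ring.
Qed.

Lemma meval_quadform q (x : 'I_n -> S) :
  (quadform q).@[x] = \sum_i \sum_j q i j * (x i * x j).
Proof.
rewrite quadformE rmorph_sum /=; apply: eq_bigr => i _.
by rewrite rmorph_sum /=; apply: eq_bigr => j _; rewrite !rmorphM /= mevalC !mevalXU.
Qed.

Lemma polar_quadform q (x y : 'I_n -> S) :
  polar (quadform q) x y = \sum_i \sum_j gram q i j * (x i * y j).
Proof.
rewrite /polar !meval_quadform -!sumrB.
have -> : \sum_i \sum_j gram q i j * (x i * y j) =
    \sum_i \sum_j (q i j * (x i * y j) + q i j * (y i * x j)).
  under [RHS]eq_bigr => i _ do rewrite big_split /=.
  rewrite big_split /= [X in _ = _ + X]exchange_big /= -big_split; apply: eq_bigr => i _ /=.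
  by rewrite -big_split; apply: eq_bigr => j _ /=; rewrite !mxE; ring.
apply: eq_bigr => i _; rewrite -!sumrB; apply: eq_bigr => j _; ring.
Qed.

Lemma polar_unit_vectors q i j :
  polar (quadform q) (fun k => (k == i)%:R) (fun k => (k == j)%:R) = gram q i j.
Proof.
rewrite polar_quadform (bigD1 i) //= (bigD1 j) //= !eqxx !mulr1.
rewrite !big1 ?addr0 // => [k /negPf Nk|k /negPf Nk].
  by rewrite big1 // => l _; rewrite Nk mul0r mulr0.
by rewrite Nk !mulr0.
Qed.

Lemma discriminant_quadform q : discriminant (quadform q) = \det (gram q).
Proof. by congr (\det _); apply/matrixP => i j; rewrite mxE polar_unit_vectors. Qed.

Lemma quadform_eq q q' : (exists t : S, 2%:R * t = 1) ->
  quadform q = quadform q' <-> gram q = gram q'.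
Proof.
move=> [t ht]; split=> h.
  by apply/matrixP => i j; rewrite -!polar_unit_vectors h.
have double p : quadform p = t *: quadform (gram p).
  rewrite quadformD quadform_tr -[quadform p + _]mulr2n -scaler_nat scalerA.
  by rewrite mulrC ht scale1r.
by rewrite double h -double.
Qed.

Lemma lin_subst_quadform_eq g q q' : (exists t : S, 2%:R * t = 1) ->
  lin_subst g (quadform q) = quadform q' <-> g^T *m gram q *m g = gram q'.
Proof. by move=> h2; rewrite lin_subst_quadform -gram_congr; apply: quadform_eq. Qed.

End QuadraticForms.

Lemma lin_equivalent_gram (S : comUnitRingType) n (q q' : 'M[S]_n) :
  (2%:R : S) \is a GRing.unit ->
  lin_equivalent (quadform q) (quadform q') <->
  exists2 g, g \in unitmx & g^T *m gram q *m g = gram q'.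
Proof.
move=> U2; have h2 : exists t : S, 2%:R * t = 1 by exists 2%:R^-1; rewrite mulrV.
by split=> -[g Ug /(lin_subst_quadform_eq _ _ _ h2) h]; exists g.
Qed.

Definition hyperbolic (S : comNzRingType) n : 'M[S]_(n + n) :=
  block_mx 0 1%:M 1%:M 0.

Lemma split_formE (S : comNzRingType) n :
  split_form S n = quadform (block_mx 0 1%:M 0 0).
Proof.
rewrite /quadform big_split_ord /= [X in _ + X]big1 ?addr0.
  apply: eq_bigr => i _; rewrite big_split_ord /= big1 ?add0r.
    rewrite (bigD1 i) //= block_mxEur mxE eqxx scale1r big1 ?addr0 // => j Nj.
    by rewrite block_mxEur mxE eq_sym (negPf Nj) scale0r.
  by move=> j _; rewrite block_mxEul mxE scale0r.
move=> i _; rewrite big1 // => j _; rewrite -[j]splitK.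
by case: (split j) => k /=; rewrite ?block_mxEdl ?block_mxEdr mxE scale0r.
Qed.

Lemma gram_split (S : comNzRingType) n :
  gram (block_mx 0 1%:M 0 0) = hyperbolic S n.
Proof. by rewrite /gram tr_block_mx add_block_mx !trmx0 trmx1 !(add0r, addr0). Qed.

Lemma hyperbolicK (S : comNzRingType) n : hyperbolic S n *m hyperbolic S n = 1%:M.
Proof.
rewrite mulmx_block !mulmx0 !mul0mx !mulmx1 !(addr0, add0r).
by rewrite -scalar_mx_block.
Qed.

Lemma hyperbolic_sym (S : comNzRingType) n : (hyperbolic S n)^T = hyperbolic S n.
Proof. by rewrite tr_block_mx !trmx0 !trmx1. Qed.

Lemma SO_splitE (R : comNzRingType) n (S : comAlgType R) (g : 'M[S]_(n + n)) :
  (exists t : R, 2%:R * t = 1) ->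
  SO_split g <-> g^T *m hyperbolic S n *m g = hyperbolic S n /\ \det g = 1.
Proof.
move=> [t ht]; have h2 : exists t : S, 2%:R * t = 1.
  by exists t%:A; rewrite mulr_natl scalerMnl -mulr_natl ht scale1r.
by rewrite /SO_split split_formE lin_subst_quadform_eq // gram_split.
Qed.

(** * Symmetric matrices over a local ring *)

Definition congruent (R : comUnitRingType) n (X Y : 'M[R]_n) :=
  exists2 g, g \in unitmx & g^T *m X *m g = Y.

Lemma block_diagA (R : nzRingType) n m (X : 'M[R]_1) (Y : 'M[R]_n) (Z : 'M[R]_m) :
  block_mx X 0 0 (block_mx Y 0 0 Z) = block_mx (block_mx X 0 0 Y) 0 0 Z
  :> 'M_(1 + (n + m)).
Proof.
have := @block_mxA R 1 n m 1 n m X 0 0 0 Y 0 0 0 Z.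
by rewrite !row_mx0 !col_mx0 => ->; apply: castmx_id.
Qed.

Section Congruence.
Variable R : comUnitRingType.

Lemma congruent_sym n (X Y : 'M[R]_n) : congruent X Y -> congruent Y X.
Proof.
move=> [g Ug <-]; exists (invmx g); first by rewrite unitmx_inv.
rewrite trmx_inv !mulmxA mulVmx ?unitmx_tr // mul1mx -mulmxA mulmxV //.
by rewrite mulmx1.
Qed.

Lemma congruent_trans n (X Y Z : 'M[R]_n) :
  congruent X Y -> congruent Y Z -> congruent X Z.
Proof.
move=> [g Ug <-] [h Uh <-]; exists (g *m h); first by rewrite unitmx_mul Ug.
by rewrite trmx_mul !mulmxA.
Qed.

Lemma congruent_block n m (X Y : 'M[R]_n) (Z T : 'M[R]_m) :
  congruent X Y -> congruent Z T ->
  congruent (block_mx X 0 0 Z) (block_mx Y 0 0 T).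
Proof.
move=> [g Ug <-] [h Uh <-]; exists (block_mx g 0 0 h).
  by rewrite unitmxE det_ublock unitrM -!unitmxE Ug.
by rewrite tr_block_mx !mulmx_block !trmx0 !(mulmx0, mul0mx, addr0, add0r).
Qed.

Lemma congruent_sym_mx n (X Y : 'M[R]_n) : congruent X Y -> X^T = X -> Y^T = Y.
Proof. by move=> [g _ <-] hX; rewrite !trmx_mul trmxK hX mulmxA. Qed.

Lemma congr_unitmx n (X Y g : 'M[R]_n) : g^T *m X *m g = Y ->
  \det Y \is a GRing.unit -> g \in unitmx.
Proof. by move=> <-; rewrite !det_mulmx unitrM -unitmxE => /andP[]. Qed.

Lemma congruent_det n (X Y : 'M[R]_n) : congruent X Y ->
  \det X \is a GRing.unit -> \det Y \is a GRing.unit.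
Proof.
by move=> [g Ug <-] UX; rewrite !det_mulmx det_tr !unitrM -unitmxE Ug UX.
Qed.

(** [A] together with its opposite is hyperbolic: the diagonal and the
    antidiagonal copies of the module are isotropic and dual to each other. *)
Lemma congruent_hyperbolic n (A : 'M[R]_n) : (2%:R : R) \is a GRing.unit ->
  A^T = A -> A \in unitmx -> congruent (block_mx A 0 0 (- A)) (hyperbolic R n).
Proof.
move=> U2 symA UA; pose W := 2%:R^-1 *: invmx A.
have AW : A *m W = 2%:R^-1%:M by rewrite -scalemxAr mulmxV // scalemx1.
have WT : W^T = W by rewrite linearZ /= trmx_inv symA.
have WA : W *m A = 2%:R^-1%:M by rewrite -scalemxAl mulVmx // scalemx1.
have h : (block_mx 1%:M W 1%:M (- W))^T *m block_mx A 0 0 (- A) *m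
    block_mx 1%:M W 1%:M (- W) = hyperbolic R n.
  have NWT : (- W)^T = - W by rewrite linearN /= WT.
  rewrite tr_block_mx !mulmx_block trmx1 WT NWT.
  rewrite !(mulmx0, mul0mx, addr0, add0r, mulmx1, mul1mx, mulmxN, mulNmx, opprK).
  by rewrite AW WA !subrr -raddfD /= -mulr2n -(mulr_natl 2%:R^-1) mulrV.
exists (block_mx 1%:M W 1%:M (- W)) => //; apply: congr_unitmx h _.
by rewrite -unitmxE; case: (mulmx1_unit (hyperbolicK R n)).
Qed.

Hypothesis local : forall x y : R,
  x + y \is a GRing.unit -> x \is a GRing.unit \/ y \is a GRing.unit.
Hypothesis unit2 : (2%:R : R) \is a GRing.unit.

Lemma local_sum k (f : 'I_k -> R) : (\sum_i f i) \is a GRing.unit ->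
  exists i, f i \is a GRing.unit.
Proof.
elim: k f => [|k IHk] f; first by rewrite big_ord0 unitr0.
rewrite big_ord_recl => /local[|/IHk[i Ui]]; first by exists ord0.
by exists (lift ord0 i).
Qed.

(** Some entry in position (0, j) is a unit; the values of the form at
    [e_0 + e_j] and [e_0 - e_j] differ by four times that entry, so that one of
    them is a unit. *)
Lemma unit_corner n (X : 'M[R]_n.+1) : X^T = X -> \det X \is a GRing.unit ->
  exists2 Y, congruent X Y & Y 0 0 \is a GRing.unit.
Proof.
move=> symX; rewrite (expand_det_row _ 0) => /local_sum[j].
rewrite unitrM => /andP[Uj _].
have [j0|j0] := eqVneq j 0.
  exists X; last by rewrite j0 in Uj.
  by exists 1%:M; rewrite ?unitmx1 // trmx1 mul1mx mulmx1.
pose d : 'M[R]_n.+1 := delta_mx j 0.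
have dd : d *m d = 0 by rewrite mul_delta_mx_0 // eq_sym.
have Xd i : (X *m d) i 0 = X i j.
  rewrite mxE (bigD1 j) //= mxE !eqxx mulr1 big1 ?addr0 // => k /negPf Nk.
  by rewrite mxE Nk mulr0.
have dZ (Z : 'M[R]_n.+1) : (d^T *m Z) 0 0 = Z j 0.
  rewrite mxE (bigD1 j) //= !mxE !eqxx mul1r big1 ?addr0 // => k /negPf Nk.
  by rewrite !mxE Nk mul0r.
pose g t : 'M[R]_n.+1 := 1%:M + t *: d.
have Ug t : g t \in unitmx.
  have /mulmx1_unit[] // : g t *m g (- t) = 1%:M.
  rewrite mulmxDl !mulmxDr !(mulmx1, mul1mx) -!scalemxAl -scalemxAr dd !scaler0 addr0.
  by rewrite scaleNr subrK.
have norm t : ((g t)^T *m X *m g t) 0 0 = X 0 0 + 2%:R * t * X 0 j + t ^+ 2 * X j j.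
  have Xj0 : X j 0 = X 0 j by rewrite -{1}symX mxE.
  have -> : (g t)^T = 1%:M + t *: d^T.
    by apply/matrixP => i k; rewrite !mxE eq_sym.
  rewrite mulmxDl mul1mx mulmxDr mulmx1 -scalemxAl.
  rewrite mulmxDl -scalemxAr -scalemxAl -scalemxAr -mulmxA.
  have E k l (P Q : 'M[R]_n.+1) : (P + Q) k l = P k l + Q k l by rewrite mxE.
  have Z k l c (P : 'M[R]_n.+1) : (c *: P) k l = c * P k l by rewrite mxE.
  by rewrite !(E, Z) !dZ !Xd Xj0; ring.
have : (X 0 0 + 2%:R * 1 * X 0 j + 1 ^+ 2 * X j j)
     + (- (X 0 0 + 2%:R * -1 * X 0 j + (-1) ^+ 2 * X j j)) \is a GRing.unit.
  have -> : (X 0 0 + 2%:R * 1 * X 0 j + 1 ^+ 2 * X j j)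
     + (- (X 0 0 + 2%:R * -1 * X 0 j + (-1) ^+ 2 * X j j)) = 2%:R * (2%:R * X 0 j).
    by ring.
  by rewrite !unitrM unit2.
move=> /local[|]; rewrite ?unitrN -norm => Ut.
  by exists ((g 1)^T *m X *m g 1) => //; exists (g 1).
by exists ((g (-1))^T *m X *m g (-1)) => //; exists (g (-1)).
Qed.

Lemma diagonalize n (X : 'M[R]_n) : X^T = X -> \det X \is a GRing.unit ->
  exists d : 'rV[R]_n, (forall i, d 0 i \is a GRing.unit) /\ congruent X (diag_mx d).
Proof.
elim: n X => [|n IHn] X symX UX.
  exists 0; split; first by case.
  by exists 1%:M; rewrite ?unitmx1 //; apply/matrixP => -[].
have [Y XY Ux] := unit_corner symX UX.
have symY := congruent_sym_mx XY symX.
have UY := congruent_det XY UX.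
pose x := Y 0 0; pose v : 'rV[R]_n := @ursubmx R 1 n 1 n Y.
pose Z : 'M[R]_n := @drsubmx R 1 n 1 n Y.
have YE : Y = block_mx x%:M v v^T Z :> 'M_(1 + n).
  rewrite -[LHS](@submxK _ 1 n 1 n); congr block_mx.
    apply/matrixP => i j; rewrite !ord1 !mxE eqxx mulr1n.
    by congr (Y _ _); apply: val_inj.
  by rewrite /v trmx_ursub symY.
pose Z' := Z - x^-1 *: (v^T *m v).
have symZ : Z^T = Z by rewrite /Z trmx_drsub symY.
have step : @congruent R (1 + n) Y (block_mx x%:M 0 0 Z').
  exists (block_mx 1%:M (- x^-1 *: v) 0 1%:M : 'M_(1 + n)).
    by rewrite unitmxE det_ublock !det1 mulr1 unitr1.
  have vT : (- x^-1 *: v)^T = - x^-1 *: v^T by rewrite linearZ.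
  rewrite {1}YE tr_block_mx !mulmx_block !trmx0 !trmx1 vT.
  rewrite !(mulmx0, mul0mx, addr0, add0r, mulmx1, mul1mx) -!scalemxAl -!scalemxAr.
  rewrite mul_scalar_mx mul_mx_scalar !scalerA mulNr mulVr //.
  by rewrite !scaleN1r !addNr mul0mx scaler0 add0r scaleNr addrC.
have symZ' : Z'^T = Z' by rewrite linearB linearZ /= symZ trmx_mul trmxK.
have UZ' : \det Z' \is a GRing.unit.
  by have := congruent_det step UY; rewrite det_ublock unitrM => /andP[].
have [d [Ud Zd]] := IHn Z' symZ' UZ'.
exists (row_mx x%:M d : 'rV_(1 + n)); split.
  suff H (i : 'I_(1 + n)) : row_mx x%:M d 0 i \is a GRing.unit by exact: H.
  by case: (split_ordP i) => j ->; rewrite ?row_mxEr // row_mxEl ord1 mxE eqxx mulr1n.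
suff H : @congruent R (1 + n) (block_mx x%:M 0 0 Z') (diag_mx (row_mx x%:M d)).
  by apply: congruent_trans XY _; apply: congruent_trans step H.
rewrite diag_mx_row; apply: congruent_block => //.
exists 1%:M; first exact: unitmx1.
rewrite trmx1 mul1mx mulmx1; apply/matrixP => i j.
by rewrite !ord1 !mxE.
Qed.

(** Write the isometry as [[p, r], [c, M]].  Changing its sign if need be, [1 + p]
    is invertible, and [M - c r / (1 + p)] is then an isometry from [X] to
    [Y]. *)
Lemma cancel_scalar n (a : R) (X Y : 'M[R]_n) : X^T = X -> \det Y \is a GRing.unit ->
  congruent (block_mx a%:M 0 0 X : 'M_(1 + n)) (block_mx a%:M 0 0 Y) ->
  congruent X Y.
Proof.
move=> symX UY [g _ Hg].
suff main (h : 'M[R]_(1 + n)) : h^T *m block_mx a%:M 0 0 X *m h = block_mx a%:M 0 0 Y ->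
    1 + h 0 0 \is a GRing.unit -> congruent X Y.
  have /local[Up|Up] : (1 + g 0 0) + (1 - g 0 0) \is a GRing.unit.
  - by rewrite (_ : _ + _ = 2%:R) //; ring.
  - exact: main Hg Up.
  have gT : (- g)^T = - g^T by rewrite linearN.
  by apply: (main (- g)); rewrite ?mxE // gT !(mulNmx, mulmxN) opprK.
move=> {g Hg} Hh; set p := h 0 0 => Up.
pose r : 'rV[R]_n := ursubmx h; pose c : 'cV[R]_n := dlsubmx h.
pose M : 'M[R]_n := drsubmx h.
have hE : h = block_mx p%:M r c M.
  rewrite -[LHS]submxK; congr block_mx; apply/matrixP => i j.
  by rewrite !ord1 !mxE eqxx mulr1n; congr (h _ _); apply: val_inj.
move: Hh; rewrite {1 2}hE tr_block_mx !mulmx_block tr_scalar_mx.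
rewrite !(mulmx0, mul0mx, addr0, add0r) => /eq_block_mx[Hul Hur _ Hdr].
have cXM : c^T *m X *m M = - (p * a) *: r.
  by apply/eqP; rewrite scaleNr -addr_eq0 addrC -Hur -scalar_mxM mul_scalar_mx.
have MXc : M^T *m X *m c = - (p * a) *: r^T.
  by rewrite -linearZ /= -cXM !trmx_mul trmxK symX mulmxA.
have cXc : c^T *m X *m c = (a - p * a * p)%:M.
  by rewrite raddfB /= -Hul !scalar_mxM addrAC subrr add0r.
have MXM : M^T *m X *m M = Y - a *: (r^T *m r).
  by rewrite -Hdr mul_mx_scalar -scalemxAl addrAC subrr add0r.
pose s := (1 + p)^-1.
have sp : s * (1 + p) = 1 by rewrite mulVr.
have h' : (M - s *: (c *m r))^T *m X *m (M - s *: (c *m r)) = Y.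
  have -> : (M - s *: (c *m r))^T = M^T - s *: (r^T *m c^T).
    by rewrite linearB linearZ /= trmx_mul.
  have E1 : M^T *m X *m (c *m r) = - (p * a) *: (r^T *m r).
    by rewrite mulmxA MXc scalemxAl.
  have E2 : r^T *m c^T *m X *m M = - (p * a) *: (r^T *m r).
    by rewrite -!mulmxA (mulmxA c^T) cXM scalemxAr.
  have E3 : r^T *m c^T *m X *m (c *m r) = (a - p * a * p) *: (r^T *m r).
    rewrite -!mulmxA (mulmxA X) (mulmxA c^T) (mulmxA c^T) cXc.
    by rewrite mul_scalar_mx scalemxAr.
  rewrite !mulmxBl !mulmxBr MXM -!scalemxAl -!scalemxAr E1 E2 E3 !scalerA.
  transitivity (Y + (- a - s * - (p * a)
      - (s * - (p * a) - s * s * (a - p * a * p))) *: (r^T *m r)).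
    by rewrite !scalerBl scaleNr !addrA.
  rewrite -[RHS]addr0 -(scale0r (r^T *m r)); congr (_ + _ *: _).
  transitivity (a * (s * (1 + p) - 1) * (1 + s * (1 - p))); last first.
    by rewrite sp subrr mulr0 mul0r.
  by ring.
by exists (M - s *: (c *m r)) => //; apply: congr_unitmx h' UY.
Qed.

Lemma witt_cancellation n m (d : 'rV[R]_n) (X Y : 'M[R]_m) :
  X^T = X -> Y^T = Y -> (forall i, d 0 i \is a GRing.unit) ->
  \det Y \is a GRing.unit ->
  congruent (block_mx (diag_mx d) 0 0 X) (block_mx (diag_mx d) 0 0 Y) ->
  congruent X Y.
Proof.
elim: n d => [|n IHn] d symX symY Ud UY XY.
  move: XY; rewrite !(flatmx0 (diag_mx d)).
  by rewrite /block_mx !col_flat_mx !row_thin_mx.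
pose d' := @rsubmx R 1 1 n d.
have dE : diag_mx d = block_mx (d 0 0)%:M 0 0 (diag_mx d') :> 'M_(1 + n).
  have d1 : @lsubmx R 1 1 n d = (d 0 0)%:M.
    apply/matrixP => i j; rewrite !ord1 !mxE eqxx mulr1n; congr (d _ _).
    exact: val_inj.
  have <- : diag_mx (d 0 0)%:M = (d 0 0)%:M :> 'M[R]_1.
    by apply/matrixP => i j; rewrite !ord1 !mxE.
  by rewrite -d1 -diag_mx_row hsubmxK.
have split_d (Z : 'M[R]_m) : block_mx (diag_mx d) 0 0 Z =
    block_mx (d 0 0)%:M 0 0 (block_mx (diag_mx d') 0 0 Z) :> 'M_(1 + (n + m)).
  by rewrite block_diagA -dE.
apply: (IHn d') => //.
- by move=> i; rewrite mxE.
apply: (@cancel_scalar _ (d 0 0)).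
- by rewrite tr_block_mx !trmx0 tr_diag_mx symX.
- rewrite det_ublock unitrM UY andbT det_diag.
  by elim/big_ind: _ => [||i _]; rewrite ?unitr1 ?mxE // => x y; rewrite unitrM => -> ->.
- by move: XY; rewrite !split_d.
Qed.

End Congruence.

(** * The algebra of isometries between two symmetric matrices *)

Local Notation "M ^ S" := (map_mx (in_alg S) M) : ring_scope.

(** Restated so that rewriting finds the coercion of an algebra morphism to a
    function. *)
Section AlgebraMorphism.
Variables (R : comNzRingType) (A S : comAlgType R) (f : {lrmorphism A -> S}).

Lemma lrmorphZ r a : f (r *: a) = r *: f a. Proof. exact: linearZ. Qed.
Lemma lrmorphM a b : f (a * b) = f a * f b. Proof. exact: rmorphM. Qed.
Lemma lrmorphN a : f (- a) = - f a. Proof. exact: rmorphN. Qed.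

End AlgebraMorphism.

Lemma lrmorph_sub_eq0 (R : comNzRingType) (A S : comAlgType R)
    (f : {lrmorphism A -> S}) a b : f (a - b) = 0 <-> f a = f b.
Proof.
have -> : f (a - b) = f a - f b by apply: rmorphB.
by split=> [/eqP|->]; [rewrite subr_eq0 => /eqP | rewrite subrr].
Qed.

Lemma map_in_alg (R : comNzRingType) (A S : comAlgType R) (f : {lrmorphism A -> S})
    m n (M : 'M[R]_(m, n)) : map_mx f (M ^ A) = M ^ S.
Proof. by apply/matrixP => i j; rewrite !mxE lrmorph_alg. Qed.

Lemma det_in_alg (R : comNzRingType) (S : comAlgType R) n (M : 'M[R]_n) :
  \det (M ^ S) = (\det M)%:A.
Proof. by rewrite det_map_mx. Qed.

Lemma generic_matrix (R : comNzRingType) N : exists (A : comAlgType R) (V : 'M[A]_N),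
  [/\ flat A,
      forall (S : comAlgType R) (h : 'M[S]_N),
        exists x : {lrmorphism A -> S}, map_mx x V = h &
      forall (S : comAlgType R) (x y : {lrmorphism A -> S}),
        map_mx x V = map_mx y V -> x =1 y].
Proof.
pose A : comAlgType R := {mpoly R[N * N]}.
pose V : 'M[A]_N := \matrix_(i, j) 'X_(mxvec_index i j).
exists A, V; split; first exact: flat_mpoly.
- move=> S h; pose v k := mxvec h 0 k.
  have [|||x xE] := @lrmorphism_of R A S (mmap (in_alg S) v).
  + exact: rmorphB.
  + by split; [exact: rmorph1 | exact: rmorphM].
  + by move=> r p; rewrite mmapZ mulr_algl.
  by exists x; apply/matrixP => i j; rewrite !mxE xE mmapX mmap1U /v mxvecE.
move=> S x y /matrixP xy p; rewrite (mpolyE p) !linear_sum; apply: eq_bigr => m _.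
rewrite !linearZ mpolyXE_id !rmorph_prod; congr (_ *: _); apply: eq_bigr => k _.
rewrite !rmorphXn; congr (_ ^+ _).
by case/mxvec_indexP: k => i j; have := xy i j; rewrite !mxE.
Qed.

Section IsometryAlgebra.
Variables (R : comNzRingType) (N : nat) (B H : 'M[R]_N) (delta : R).

Definition isometry (S : comAlgType R) (g : 'M[S]_N) :=
  g^T *m B ^ S *m g = H ^ S /\ \det g = delta%:A.

Lemma isometry_map (S T : comAlgType R) (f : {lrmorphism S -> T}) (g : 'M[S]_N) :
  isometry g -> isometry (map_mx f g).
Proof.
move=> [gB gd]; split; last by rewrite det_map_mx gd; apply: lrmorph_alg.
by rewrite map_trmx -(map_in_alg f B) -!map_mxM gB map_in_alg.
Qed.

(** Dividing the algebra of the generic matrix by all functions that vanish at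
    every isometry, instead of by the entries of the matrix equations, gives the
    same ideal and makes the universal property immediate; the isometry [g0]
    shows that the quotient is not zero. *)
Lemma isometry_algebra (S0 : comAlgType R) (g0 : 'M[S0]_N) : isometry g0 ->
  exists (E : comAlgType R) (eta : 'M[E]_N),
  [/\ isometry eta,
      forall (S : comAlgType R) (h : 'M[S]_N), isometry h ->
        exists x : {lrmorphism E -> S}, map_mx x eta = h &
      forall (S : comAlgType R) (x y : {lrmorphism E -> S}),
        map_mx x eta = map_mx y eta -> x =1 y].
Proof.
move=> iso0; have [A [V [_ lift uniq]]] := generic_matrix R N.
pose I (a : A) := forall (S : comAlgType R) (x : {lrmorphism A -> S}),
  isometry (map_mx x V) -> x a = 0.
have hI : is_ideal I.
  split=> [S x _|a b c Ib Ic S x hx]; first exact: rmorph0.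
  transitivity (x a * x b + x c); first by rewrite rmorphD rmorphM.
  by rewrite (Ib S x hx) (Ic S x hx) mulr0 addr0.
have NI1 : ~ I 1.
  have [x0 x0V] := lift S0 g0; move=> /(_ S0 x0); rewrite x0V => /(_ iso0).
  by move=> /eqP; rewrite rmorph1 oner_eq0.
have [E [p [surj ker palg]]] := @quotient_algebraP R A (in_alg A) I hI NI1.
have [|||pi piE] := @lrmorphism_of R A E p.
- exact: rmorphB.
- by split; [exact: rmorph1 | exact: rmorphM].
- by move=> r a; rewrite -mulr_algl rmorphM palg mulr_algl.
have vanish a : I a -> pi a = 0 by move=> Ia; rewrite piE; apply/ker.
have equal a b : I (a - b) -> pi a = pi b by move=> /vanish/lrmorph_sub_eq0.
have isoE : isometry (map_mx pi V).
  split.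
    rewrite map_trmx -!(map_in_alg pi) -!map_mxM; apply/matrixP => i j.
    rewrite [LHS]mxE [RHS]mxE; apply: equal => S x [hB _].
    apply/lrmorph_sub_eq0; have := congr1 (fun M : 'M_N => M i j) hB.
    by rewrite map_trmx -!(map_in_alg x) -!map_mxM /= mxE [RHS]mxE.
  rewrite det_map_mx -(lrmorph_alg pi); apply: equal => S x [_].
  rewrite det_map_mx => hd; apply/lrmorph_sub_eq0.
  by rewrite -(lrmorph_alg x) in hd.
exists E, (map_mx pi V); split=> // [S h isoh|S x y xy z].
  have [x xV] := lift S h.
  have [||F FE] := @quotient_algebra_lift R A (in_alg A) E S p x surj palg.
  - by move=> r; apply: lrmorph_alg.
  - by move=> c /ker; apply; rewrite xV.
  by exists F; rewrite -xV; apply/matrixP => i j; rewrite !mxE piE FE.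
have [c ->] := surj z; have <- : pi c = p c by apply: piE.
apply: (uniq S (x \o pi) (y \o pi)).
by apply/matrixP => i j; move/matrixP: xy => /(_ i j); rewrite !mxE.
Qed.

End IsometryAlgebra.

(** * Gram-Schmidt orthogonalisation and flatness *)

Section GramSchmidt.
Variables (R : comNzRingType) (N : nat) (B : 'M[R]_N) (c c' : 'rV[R]_N).
Hypothesis symB : B^T = B.
Hypothesis cK : forall i, c 0 i * c' 0 i = 1.

Local Notation D := (diag_mx c).

Section Step.
Variables (S : comAlgType R) (V : 'M[S]_N) (k : 'I_N) (s : S).

Let G := V^T *m B ^ S *m V.

Let rho : 'rV[S]_N :=
  \row_j (if j == k then s - 1 else - (c' 0 k *: (s ^+ 2 * G k j))).

(** The factor on the right differs from the identity in its row [k] only: it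
    multiplies the column [k] of [V] by [s], and subtracts multiples of it from
    the other columns so as to make them orthogonal to it. *)
Definition gram_schmidt_step : 'M[S]_N :=
  V *m (1%:M + delta_mx k 0 *m rho).

Lemma gram_schmidt_stepP :
  (forall i j : 'I_N, (i < k)%N -> G i j = (D ^ S) i j) ->
  (c' 0 k *: G k k) * s ^+ 2 = 1 ->
  forall i j : 'I_N, (i < k.+1)%N ->
    (gram_schmidt_step^T *m B ^ S *m gram_schmidt_step) i j = (D ^ S) i j.
Proof.
move=> Glt + i j.
have symG a b : G a b = G b a.
  have : G^T = G by rewrite /G !trmx_mul trmxK map_trmx symB mulmxA.
  by move/matrixP => /(_ b a); rewrite mxE.
have DE a b : (D ^ S) a b = (c 0 a *+ (a == b))%:A by rewrite !mxE.
have GE a b : (gram_schmidt_step^T *m B ^ S *m gram_schmidt_step) a b =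
    G a b + rho 0 a * G k b + G a k * rho 0 b + rho 0 a * (G k k * rho 0 b).
  have -> : gram_schmidt_step^T *m B ^ S *m gram_schmidt_step =
      (1%:M + rho^T *m delta_mx 0 k) *m G *m (1%:M + delta_mx k 0 *m rho).
    rewrite /gram_schmidt_step trmx_mul /G.
    have -> : (1%:M + delta_mx k 0 *m rho)^T = 1%:M + rho^T *m delta_mx 0 k.
      by rewrite linearD /= trmx1 trmx_mul trmx_delta.
    by rewrite !mulmxA.
  have ME (P Q : 'M[S]_N) x y : (P + Q) x y = P x y + Q x y by rewrite mxE.
  have left_mul (P : 'M[S]_N) x y :
      (rho^T *m delta_mx 0 k *m P) x y = rho 0 x * P k y.
    by rewrite -mulmxA -rowE mxE big_ord1 !mxE.
  have right_mul (P : 'M[S]_N) x y :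
      (P *m (delta_mx k 0 *m rho)) x y = P x k * rho 0 y.
    by rewrite mulmxA -colE mxE big_ord1 !mxE.
  rewrite mulmxDr mulmx1 mulmxDl mul1mx !ME right_mul ME !left_mul; ring.
have rhoE x : rho 0 x = if x == k then s - 1 else - ((c' 0 k)%:A * (s ^+ 2 * G k x)).
  by rewrite mxE mulr_algl.
rewrite -mulr_algl => /= Gkk; rewrite ltnS leq_eqVlt => /orP[/eqP ik|ik]; last first.
  have Nik : i == k = false by apply/negP => /eqP E; rewrite E ltnn in ik.
  have Gik : G i k = 0 by rewrite Glt // DE Nik mulr0n scale0r.
  have Gki : G k i = 0 by rewrite symG.
  by rewrite GE rhoE Nik Gik Gki !(mulr0, mul0r, oppr0, addr0) Glt.
have {ik}-> : i = k by apply: val_inj.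
rewrite GE !rhoE eqxx DE; have [->|Njk] := eqVneq j k.
  have cc : (c 0 k)%:A * (c' 0 k)%:A = 1 :> S.
    by rewrite -scalerAl mul1r scalerA cK scale1r.
  transitivity (G k k * s ^+ 2); first by ring.
  rewrite -[LHS]mul1r -[X in X * _]cc; transitivity ((c 0 k)%:A * ((c' 0 k)%:A * G k k * s ^+ 2)).
    by ring.
  by rewrite Gkk mulr1 mulr1n.
rewrite mulr0n scale0r.
transitivity (s * G k j * (1 - (c' 0 k)%:A * G k k * s ^+ 2)); first by ring.
by rewrite Gkk subrr mulr0.
Qed.

End Step.
(** Each step adjoins to a flat algebra the inverse square root of the norm of one
    column.  Over an algebra where the columns are orthogonal with the required
    norms already, the steps change nothing when the roots are taken to be 1. *)
Lemma gram_schmidt (E : comAlgType R) (eta : 'M[E]_N) :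
  eta^T *m B ^ E *m eta = D ^ E ->
  exists (A : comAlgType R) (V : 'M[A]_N) (psi : {lrmorphism A -> E}),
    [/\ flat A, V^T *m B ^ A *m V = D ^ A & map_mx psi V = eta].
Proof.
move=> etaB.
suff main k : (k <= N)%N -> exists (A : comAlgType R) (V : 'M[A]_N)
    (psi : {lrmorphism A -> E}), [/\ flat A,
      forall i j : 'I_N, (i < k)%N -> (V^T *m B ^ A *m V) i j = (D ^ A) i j &
      map_mx psi V = eta].
  have [A [V [psi [flatA VB psiV]]]] := main N (leqnn N).
  by exists A, V, psi; split=> //; apply/matrixP => i j; apply: VB.
elim: k => [|k IHk] lekN.
  have [A [V [flatA lift _]]] := generic_matrix R N.
  by have [psi psiV] := lift E eta; exists A, V, psi.
have [A [V [psi [flatA VB psiV]]]] := IHk (ltnW lekN).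
pose k0 := Ordinal lekN; pose G := V^T *m B ^ A *m V.
have psiG i j : psi (G i j) = (D ^ E) i j.
  rewrite -etaB -psiV map_trmx -(map_in_alg psi) -!map_mxM.
  by rewrite [RHS]mxE.
have [|A' [iota [s [psi' [flatA' Hs psi'E psi's]]]]] :=
    @sqrt_extension R A (c' 0 k0 *: G k0 k0) E psi 1.
  by rewrite lrmorphZ psiG !mxE eqxx mulr1n expr1n mulr1 scalerA mulrC cK scale1r.
pose V1 := map_mx iota V.
have GE i j : (V1^T *m B ^ A' *m V1) i j = iota (G i j).
  by rewrite map_trmx -(map_in_alg iota) -!map_mxM [LHS]mxE.
exists A', (gram_schmidt_step V1 k0 s), psi'; split; first exact: flatA'.
  apply: (gram_schmidt_stepP (k := k0)) => [i j ik|].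
    by rewrite GE VB // -(map_in_alg iota) [RHS]mxE.
  by rewrite GE -Hs lrmorphZ.
rewrite /gram_schmidt_step map_mxM.
have -> : map_mx psi' V1 = eta.
  by rewrite -psiV; apply/matrixP => i j; rewrite !mxE psi'E.
rewrite -[RHS]mulmx1; congr (_ *m _); rewrite map_mxD map_mx1 map_mxM.
set rho := map_mx psi' (\row_j _); suff -> : rho = 0 by rewrite mulmx0 addr0.
apply/rowP => j; rewrite [LHS]mxE [X in psi' X]mxE [RHS]mxE.
case: eqVneq => [_|Njk].
  by apply/lrmorph_sub_eq0; rewrite psi's; apply/esym/rmorph1.
rewrite lrmorphN lrmorphZ lrmorphM GE psi'E psiG !mxE eq_sym (negPf Njk) mulr0n.
by rewrite rmorph0 mulr0 scaler0 oppr0.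
Qed.

End GramSchmidt.

Section Normalise.
Variables (R : comNzRingType) (m : nat).
Local Notation N := m.+1.
Variables (B H v w : 'M[R]_N) (c : 'rV[R]_N) (delta delta' detB' : R).
Hypotheses (vw : v *m w = 1%:M) (wH : w^T *m diag_mx c *m w = H).
Hypotheses (deltaK : delta * delta' = 1) (detBK : \det B * detB' = 1).
Hypothesis detBH : delta ^+ 2 * \det B = \det H.

(** Going back to the basis in which [H] is given turns [V] into an isometry up to
    the determinant, which is [delta] times an element of square 1; that element
    is corrected on one column. *)
Lemma isometry_of_orthogonal (S : comAlgType R) (V : 'M[S]_N) :
  V^T *m B ^ S *m V = diag_mx c ^ S ->
  exists2 g : 'M[S]_N, isometry B H delta g &
    forall (T : comAlgType R) (f : {lrmorphism S -> T}) (eta : 'M[T]_N),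
      isometry B H delta eta -> map_mx f V = eta *m v ^ T -> map_mx f g = eta.
Proof.
move=> VB.
have algM (T : comAlgType R) (a b : R) : (a * b)%:A = a%:A * b%:A :> T.
  exact: (rmorphM (in_alg T)).
pose x := \det V * (\det w)%:A; pose y : S := delta'%:A.
have Dy (T : comAlgType R) : delta%:A * delta'%:A = 1 :> T.
  by rewrite -algM deltaK scale1r.
have hB : (\det B)%:A * (detB')%:A = 1 :> S by rewrite -algM detBK scale1r.
have x2 : x ^+ 2 = delta%:A ^+ 2.
  have := congr1 determinant VB; rewrite !det_mulmx det_tr !det_in_alg => hV.
  have := congr1 determinant wH; rewrite !det_mulmx det_tr -detBH => hw.
  rewrite -[LHS]mulr1 -hB /x.
  transitivity ((\det V * (\det B)%:A * \det V) * (\det w)%:A ^+ 2 * (detB')%:A).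
    by ring.
  have -> : \det V * (\det B)%:A * \det V * (\det w)%:A ^+ 2 =
      (delta ^+ 2 * \det B)%:A by rewrite hV -hw !algM; ring.
  by rewrite !algM -!mulrA hB mulr1.
have eps2 : (x * y) ^+ 2 = 1 by rewrite exprMn x2 -exprMn Dy expr1n.
pose J (T : comAlgType R) (e : T) : 'M[T]_N :=
  diag_mx (\row_i if i == 0 then e else 1).
have detJ (T : comAlgType R) (e : T) : \det (J T e) = e.
  rewrite det_diag big_ord_recl mxE eqxx big1 ?mulr1 // => i _.
  by rewrite mxE.
have JDJ : (J S (x * y))^T *m diag_mx c ^ S *m J S (x * y) = diag_mx c ^ S.
  rewrite tr_diag_mx map_diag_mx !mulmx_diag; congr diag_mx; apply/rowP => i.
  rewrite !mxE; case: eqP => _; last by rewrite mul1r mulr1.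
  by rewrite mulrAC -expr2 eps2 mul1r.
exists (V *m J S (x * y) *m w ^ S).
  split.
    transitivity ((w ^ S)^T *m ((J S (x * y))^T *m (V^T *m B ^ S *m V) *m J S (x * y))
      *m w ^ S); first by rewrite !trmx_mul !mulmxA.
    by rewrite VB JDJ map_trmx -!map_mxM wH.
  rewrite !det_mulmx detJ det_in_alg.
  transitivity (x ^+ 2 * y); first by rewrite /x; ring.
  by rewrite x2 expr2 -mulrA Dy mulr1.
move=> T f eta [etaB etad] fV.
have detv : \det v * \det w = 1 by rewrite -det_mulmx vw det1.
have fxy : f (x * y) = 1.
  transitivity (f (\det V) * f (\det w)%:A * f delta'%:A); first by rewrite !rmorphM.
  have -> : f (\det V) = \det (map_mx f V) by rewrite det_map_mx.
  rewrite fV det_mulmx det_in_alg etad !lrmorph_alg -[_ * _ * (\det w)%:A]mulrA -algM.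
  by rewrite detv scale1r mulr1 Dy.
rewrite !map_mxM fV map_in_alg.
have -> : map_mx f (J S (x * y)) = 1%:M.
  rewrite map_diag_mx -diag_const_mx; congr diag_mx; apply/rowP => i; rewrite !mxE.
  by case: eqP => _; [exact: fxy | exact: rmorph1].
by rewrite mulmx1 -mulmxA -map_mxM vw map_mx1 mulmx1.
Qed.

End Normalise.

(** * The bundle of isometries *)

Section IsometryBundle.
Variables (R : comUnitRingType) (n' : nat).
Local Notation n := n'.+1.
Local Notation N := (n + n)%N.
Local Notation H := (hyperbolic R n).
Variables (B : 'M[R]_N) (delta : R).
Hypotheses (unit2 : (2%:R : R) \is a GRing.unit) (symB : B^T = B).
Hypotheses (unit_delta : delta \is a GRing.unit) (unitB : \det B \is a GRing.unit).
Hypothesis detBH : delta ^+ 2 * \det B = \det H.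
Hypothesis local : forall x y : R,
  x + y \is a GRing.unit -> x \is a GRing.unit \/ y \is a GRing.unit.

Local Notation isometry := (isometry B H delta).

Let half : exists t : R, 2%:R * t = 1.
Proof. by exists 2%:R^-1; rewrite mulrV. Qed.

Let unitH : \det H \is a GRing.unit.
Proof. by rewrite -unitmxE; case: (mulmx1_unit (hyperbolicK R n)). Qed.

Let H_alg (S : comAlgType R) : H ^ S = hyperbolic S n.
Proof. by rewrite map_block_mx !map_mx0 !map_mx1. Qed.

Lemma diagonal_basis (X : 'M[R]_N) : X^T = X -> \det X \is a GRing.unit ->
  exists (d : 'rV[R]_N) (v w : 'M[R]_N),
  [/\ forall i, d 0 i \is a GRing.unit, v *m w = 1%:M, v^T *m X *m v = diag_mx d &
      w^T *m diag_mx d *m w = X].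
Proof.
move=> symX UX; have [d [Ud [v Uv vX]]] := diagonalize local unit2 symX UX.
exists d, v, (invmx v); split=> //; first exact: mulmxV.
by rewrite -vX trmx_inv !mulmxA mulVmx ?unitmx_tr // mul1mx -mulmxA mulmxV // mulmx1.
Qed.

(** Adjoining square roots of the ratios between the diagonal forms of [B] and
    [H] yields an isometry. *)
Lemma isometry_exists : exists (S : comAlgType R) (l : S -> R) (g : 'M[S]_N),
  unit_retraction l /\ isometry g.
Proof.
have [c [v [w [Uc vw _ wH]]]] := diagonal_basis (hyperbolic_sym R n) unitH.
have [b [u [_ [Ub _ uB _]]]] := diagonal_basis symB unitB.
have ratio i : (b 0 i / c 0 i) * (c 0 i / b 0 i) = 1.
  by rewrite mulrA divrK // divrr.
have [S [s [l [Hs Hl]]]] := sqrts_retraction ratio.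
have [|||g isog _] := @isometry_of_orthogonal R _ B H v w c delta delta^-1 (\det B)^-1
    vw wH _ _ detBH S (u ^ S *m diag_mx (\row_i s i)).
- exact: mulrV.
- exact: mulrV.
- transitivity ((diag_mx (\row_i s i))^T *m ((u ^ S)^T *m B ^ S *m u ^ S)
    *m diag_mx (\row_i s i)); first by rewrite trmx_mul !mulmxA.
  rewrite map_trmx -!map_mxM uB tr_diag_mx.
  rewrite !map_diag_mx !mulmx_diag; congr diag_mx; apply/rowP => i; rewrite !mxE.
  rewrite /=; transitivity ((b 0 i)%:A * s i ^+ 2); first by ring.
  have -> : (b 0 i)%:A = (c 0 i)%:A * (b 0 i / c 0 i)%:A :> S.
    by rewrite -scalerAl mul1r scalerA mulrCA mulrV // mulr1.
  by rewrite -mulrA Hs mulr1.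
by exists S, l, g.
Qed.

Section Bundle.
Variables (E : comAlgType R) (eta : 'M[E]_N).
Hypotheses (isoE : isometry eta)
  (liftE : forall (S : comAlgType R) (h : 'M[S]_N), isometry h ->
     exists x : {lrmorphism E -> S}, map_mx x eta = h)
  (uniqE : forall (S : comAlgType R) (x y : {lrmorphism E -> S}),
     map_mx x eta = map_mx y eta -> x =1 y).

(** Orthogonalising the generic isometry, written in a basis where [H] is diagonal,
    presents [E] as a retract of a flat algebra. *)
Lemma isometry_flat : flat E.
Proof.
have [c [v [w [Uc vw vH wH]]]] := diagonal_basis (hyperbolic_sym R n) unitH.
have cK i : c 0 i * (\row_i (c 0 i)^-1) 0 i = 1 by rewrite mxE mulrV.
have [|A [V [psi [flatA VB psiV]]]] := gram_schmidt symB cK (eta := eta *m v ^ E).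
  transitivity ((v ^ E)^T *m (eta^T *m B ^ E *m eta) *m v ^ E).
    by rewrite trmx_mul !mulmxA.
  by rewrite isoE.1 map_trmx -!map_mxM vH.
have [||g isog gE] := @isometry_of_orthogonal R _ B H v w c delta delta^-1 (\det B)^-1
    vw wH _ _ detBH A V VB.
- exact: mulrV.
- exact: mulrV.
have [x xE] := liftE isog.
apply: (@flat_retract R E A x psi) flatA => z.
apply: (uniqE (x := psi \o x) (y := idfun)).
by rewrite map_mx_comp xE (gE _ _ _ isoE psiV) map_mx_id.
Qed.

Lemma isometry_faithfully_flat : faithfully_flat E.
Proof.
split=> [|M]; first exact: isometry_flat.
have [S [l [g [Hl isog]]]] := isometry_exists; have [x _] := liftE isog.
exact: (@faithful_of_retraction R E S x l M Hl).
Qed.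

Let SOE (S : comAlgType R) (g : 'M[S]_N) := SO_splitE g half.

Lemma isometry_mulmx (S : comAlgType R) (h g : 'M[S]_N) :
  isometry h -> SO_split g -> isometry (h *m g).
Proof.
move=> [hB hd] /SOE[gH gd]; split; last by rewrite det_mulmx hd gd mulr1.
transitivity (g^T *m (h^T *m B ^ S *m h) *m g); first by rewrite trmx_mul !mulmxA.
by rewrite hB H_alg.
Qed.

Lemma isometry_simply_transitive (S : comAlgType R) (h k : 'M[S]_N) :
  isometry h -> isometry k -> exists! g : 'M[S]_N, SO_split g /\ h *m g = k.
Proof.
have HK : (H ^ S) *m (H ^ S) = 1%:M by rewrite -map_mxM hyperbolicK map_mx1.
have HT : (H ^ S)^T = H ^ S by rewrite map_trmx hyperbolic_sym.
have BT : (B ^ S)^T = B ^ S by rewrite map_trmx symB.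
have UD : delta%:A * (delta^-1)%:A = 1 :> S.
  by rewrite -scalerAl mul1r scalerA divrr // scale1r.
move=> [hB hd] [kB kd].
(* an isometry h has the inverse H h^T B *)
have hK : H ^ S *m h^T *m B ^ S *m h = 1%:M.
  by rewrite -!mulmxA (mulmxA h^T) hB HK.
have hK' : h *m (H ^ S *m h^T *m B ^ S) = 1%:M by apply: mulmx1C.
exists (H ^ S *m h^T *m B ^ S *m k); split; last first.
  by move=> g [_ <-]; rewrite mulmxA hK mul1mx.
have hg : h *m (H ^ S *m h^T *m B ^ S *m k) = k by rewrite mulmxA hK' mul1mx.
split=> //; move: (_ *m k) hg => g hg; apply/SOE; rewrite -H_alg; split.
  transitivity (g^T *m (h^T *m B ^ S *m h) *m g); first by rewrite hB.
  transitivity ((h *m g)^T *m B ^ S *m (h *m g)); first by rewrite trmx_mul !mulmxA.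
  by rewrite hg.
have := congr1 determinant hg; rewrite det_mulmx hd kd => Eg.
by rewrite -[LHS]mul1r -UD mulrAC Eg UD.
Qed.

(* outside the group, the action is the identity *)
Let moved (S : comAlgType R) (x : {lrmorphism E -> S}) (g : 'M[S]_N) :
  exists y : {lrmorphism E -> S}, (SO_split g -> map_mx y eta = map_mx x eta *m g) /\
    (~ SO_split g -> y = x).
Proof.
have [Gg|Ng] := classic (SO_split g); last by exists x.
by have [y yE] := liftE (isometry_mulmx (isometry_map x isoE) Gg); exists y.
Qed.

Let act (S : comAlgType R) (x : {lrmorphism E -> S}) (g : 'M[S]_N) :
    {lrmorphism E -> S} :=
  sval (constructive_indefinite_description _ (moved x g)).

Let actE (S : comAlgType R) (x : {lrmorphism E -> S}) (g : 'M[S]_N) :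
  SO_split g -> map_mx (act x g) eta = map_mx x eta *m g.
Proof. by rewrite /act; case: constructive_indefinite_description => y []. Qed.

Let eq_map (S : comAlgType R) (x y : {lrmorphism E -> S}) :
  x =1 y -> map_mx x eta = map_mx y eta.
Proof. by move=> xy; apply/matrixP => i j; rewrite !mxE. Qed.

Let SO_map (S T : comAlgType R) (u : {lrmorphism S -> T}) (g : 'M[S]_N) :
  SO_split g -> SO_split (map_mx u g).
Proof.
move=> /SOE[gH gd]; apply/SOE; split; last by rewrite det_map_mx gd rmorph1.
by rewrite map_trmx -!H_alg -!(map_in_alg u) -!map_mxM H_alg gH.
Qed.

Let SO_one (S : comAlgType R) : SO_split (1%:M : 'M[S]_N).
Proof. by apply/SOE; rewrite trmx1 mul1mx mulmx1 det1. Qed.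

Let SO_mul (S : comAlgType R) (g h : 'M[S]_N) :
  SO_split g -> SO_split h -> SO_split (g *m h).
Proof.
move=> /SOE[gH gd] /SOE[hH hd]; apply/SOE; split; last first.
  by rewrite det_mulmx gd hd mulr1.
transitivity (h^T *m (g^T *m hyperbolic S n *m g) *m h).
  by rewrite trmx_mul !mulmxA.
by rewrite gH.
Qed.

Let act_nat (S T : comAlgType R) (u : {lrmorphism S -> T})
    (x : {lrmorphism E -> S}) (y : {lrmorphism E -> T}) (g : 'M[S]_N) :
  SO_split g -> (forall b, y b = u (x b)) ->
  forall b, act y (map_mx u g) b = u (act x g b).
Proof.
move=> Gg yE; apply: (uniqE (y := u \o act x g)).
rewrite actE; last exact: SO_map.
have -> : map_mx y eta = map_mx u (map_mx x eta).
  by apply/matrixP => i j; rewrite !mxE.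
rewrite -map_mxM -actE //.
by apply/matrixP => i j; rewrite !mxE.
Qed.

Let act_1 (S : comAlgType R) (x : {lrmorphism E -> S}) : act x 1%:M =1 x.
Proof. by apply: uniqE; rewrite (actE x (SO_one S)) mulmx1. Qed.

Let act_M (S : comAlgType R) (x : {lrmorphism E -> S}) (g h : 'M[S]_N) :
  SO_split g -> SO_split h -> act x (g *m h) =1 act (act x g) h.
Proof.
move=> Gg Gh; apply: uniqE; rewrite !actE ?mulmxA //.
exact: SO_mul.
Qed.

Let act_trans (S : comAlgType R) (x y : {lrmorphism E -> S}) :
  exists! g : 'M[S]_N, SO_split g /\ act x g =1 y.
Proof.
have [g [[Gg xg] uniq_g]] :=
  isometry_simply_transitive (isometry_map x isoE) (isometry_map y isoE).
exists g; split; first by split=> //; apply: uniqE; rewrite actE.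
by move=> h [Gh /eq_map]; rewrite actE // => xh; apply: uniq_g.
Qed.

Definition isometry_bundle : principal_bundle (@SO_split R n) :=
  @PrincipalBundle R N (@SO_split R n) E act act_nat act_1 act_M act_trans
    isometry_faithfully_flat.

Lemma isometry_bundle_trivial (A : comAlgType R) (g : 'M[A]_N) :
  isometry g -> trivial_over isometry_bundle A.
Proof.
move=> /liftE[x0 _].
exists (fun (S : comAlgType R) (a : {lrmorphism A -> S}) g => act (a \o x0) g); split.
- by move=> S T a a' u h Gh aE b; apply: act_nat => // z; apply: aE.
- by move=> S a h k Gh Gk; apply: act_M.
by move=> S a x; apply: act_trans.
Qed.

End Bundle.

End IsometryBundle.

(** * From the fraction field to the ring *)

Lemma fraction_split (R : idomainType) (x : {fraction R}) :
  exists a b : R, b != 0 /\ x * tofrac b = tofrac a.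
Proof.
pose r := (repr x : {ratio R}); exists (frac r).1, (frac r).2.
split; first exact: denom_ratioP.
rewrite -[x]reprK -/r; unlock tofrac; rewrite -[LHS]FracField.pi_mul.
apply/eqP; rewrite FracField.equivf_def /FracField.mulf /=.
by rewrite !numden_Ratio ?mulr1 ?mulf_neq0 ?oner_neq0 ?denom_ratioP //= mulrC.
Qed.

(** The determinant of the isometry over the fraction field has a unit of [R] as
    its square, so it lies in [R] by normality.  Hence the isometries with this
    determinant form a bundle over [R], with a point over the fraction field; by
    the conjecture it has a point over [R]. *)
Lemma congruent_split (R : idomainType) (n : nat) (B : 'M[R]_(n.+1 + n.+1)) :
  regular_local R -> grothendieck_serre (@SO_split R n.+1) ->
  (2%:R : R) \is a GRing.unit -> B^T = B -> \det B \is a GRing.unit ->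
  congruent (map_mx (@tofrac R) B) (hyperbolic {fraction R} n.+1) ->
  congruent B (hyperbolic R n.+1).
Proof.
move=> regR GS U2 symB UB [gK _ gKB].
have UH : \det (hyperbolic R n.+1) \is a GRing.unit.
  by rewrite -unitmxE; case: (mulmx1_unit (hyperbolicK R n.+1)).
have local := regular_local_addN regR.
have HK : hyperbolic {fraction R} n.+1 = map_mx (@tofrac R) (hyperbolic R n.+1).
  by rewrite map_block_mx !map_mx0 !map_mx1.
have detK : \det gK ^+ 2 * tofrac (\det B) = tofrac (\det (hyperbolic R n.+1)).
  by rewrite -!det_map_mx -HK -gKB !det_mulmx det_tr expr2 mulrAC.
have [delta detd] : exists delta, \det gK = tofrac delta.
  have [a [b [b0 Eab]]] := fraction_split (\det gK).
  have [||c Ec] := regular_root (u := \det (hyperbolic R n.+1) / \det B) (a := a) (b := b)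
      regR U2.
  - by rewrite unitrM UH unitrV.
  - apply: (mulIr UB); rewrite [RHS]mulrAC divrK //.
    apply/eqP; rewrite -tofrac_eq !tofracM -Eab -detK.
    by apply/eqP; ring.
  exists c; apply: (mulIf (_ : tofrac b != 0)); first by rewrite tofrac_eq0.
  by rewrite Eab Ec tofracM.
have detBH : delta ^+ 2 * \det B = \det (hyperbolic R n.+1).
  by apply/eqP; rewrite -tofrac_eq tofracM tofracXn -detd detK.
have Ud : delta \is a GRing.unit.
  by have := UH; rewrite -detBH unitrM unitrX_pos // => /andP[].
have algK (M : 'M[R]_(n.+1 + n.+1)) : M ^ (fracalg R) = map_mx (@tofrac R) M.
  by apply/matrixP => i j; rewrite !mxE; apply: mulr1.
have isoK : @isometry R _ B (hyperbolic R n.+1) delta (fracalg R) gK.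
  split; first by rewrite !algK -HK.
  by rewrite detd; apply/esym/mulr1.
have [S [l [g [_ isog]]]] := isometry_exists U2 symB Ud UB detBH local.
have [E [eta [isoE liftE uniqE]]] := isometry_algebra isog.
have trivK := isometry_bundle_trivial U2 symB Ud UB detBH local isoE liftE uniqE isoK.
have [phi _] := GS _ trivK.
pose x := phi (R^o : comAlgType R) idfun 1%:M.
have [hB _] := isometry_map (x : {lrmorphism E -> (R^o : comAlgType R)}) isoE.
have algR (M : 'M[R]_(n.+1 + n.+1)) : M ^ (R^o) = M.
  by apply/matrixP => i j; rewrite !mxE; apply: mulr1.
rewrite !algR in hB.
exists (map_mx x eta) => //; exact: congr_unitmx hB UH.
Qed.

Theorem theorem3 (R : idomainType) (n : nat) (q q' : 'M[R]_n)
  (hreg : regular_local R)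
  (hGS : grothendieck_serre (@SO_split R n))
  (h2 : (2%:R : R) \is a GRing.unit)
  (hQ : discriminant (quadform q) \is a GRing.unit)
  (hQ' : discriminant (quadform q') \is a GRing.unit)
  (hfrac : lin_equivalent (quadform (map_mx (@tofrac R) q))
                          (quadform (map_mx (@tofrac R) q'))) :
  lin_equivalent (quadform q) (quadform q').
Proof.
apply/(lin_equivalent_gram _ _ h2); rewrite -/(congruent _ _).
rewrite !discriminant_quadform in hQ hQ'.
case: n q q' hGS hQ hQ' hfrac => [|n] q q' hGS hQ hQ' hfrac.
  by exists 1%:M; rewrite ?unitmx1 //; apply/matrixP => -[].
have local := regular_local_addN hreg.
set A := gram q in hQ *; set A' := gram q' in hQ' *.
have symA : A^T = A by apply: gram_sym.
have symA' : A'^T = A' by apply: gram_sym.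
have UA : A \in unitmx by rewrite unitmxE.
have h2K : (2%:R : {fraction R}) \is a GRing.unit.
  by rewrite -(rmorph_nat (@tofrac R)) rmorph_unit.
have gramK (p : 'M[R]_n.+1) : gram (map_mx (@tofrac R) p) = map_mx (@tofrac R) (gram p).
  by rewrite /gram map_mxD map_trmx.
have AK : congruent (map_mx (@tofrac R) A) (map_mx (@tofrac R) A').
  by move/(lin_equivalent_gram _ _ h2K): hfrac; rewrite !gramK.
have blockK : congruent (map_mx (@tofrac R) (block_mx A 0 0 (- A')))
    (hyperbolic {fraction R} n.+1).
  rewrite map_block_mx !map_mx0 map_mxN.
  have symAK : (map_mx (@tofrac R) A)^T = map_mx (@tofrac R) A.
    by rewrite map_trmx symA.
  have UAK : map_mx (@tofrac R) A \in unitmx.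
    by rewrite unitmxE det_map_mx rmorph_unit.
  apply: congruent_trans (congruent_hyperbolic h2K symAK UAK).
  apply: congruent_block; first by exists 1%:M; rewrite ?unitmx1 // trmx1 mul1mx mulmx1.
  have [g Ug <-] := congruent_sym AK; exists g => //.
  by rewrite mulmxN mulNmx.
have symB : (block_mx A 0 0 (- A'))^T = block_mx A 0 0 (- A').
  by rewrite tr_block_mx !trmx0 symA linearN /= symA'.
have UNA M : \det (M : 'M[R]_n.+1) \is a GRing.unit -> \det (- M) \is a GRing.unit.
  by rewrite -scaleN1r detZ unitrM => ->; rewrite unitrX // unitrN1.
have UB : \det (block_mx A 0 0 (- A')) \is a GRing.unit.
  by rewrite det_ublock unitrM hQ UNA.
(* both sides are hyperbolic; the summand A can be cancelled *)
have BA : congruent (block_mx A 0 0 (- A')) (block_mx A 0 0 (- A)).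
  apply: congruent_trans (congruent_split hreg hGS h2 symB UB blockK) _.
  by apply: congruent_sym; apply: congruent_hyperbolic.
have [d [Ud Ad]] := diagonalize local h2 symA hQ.
have reflN (M : 'M[R]_n.+1) : congruent M M.
  by exists 1%:M; rewrite ?unitmx1 // trmx1 mul1mx mulmx1.
have [|||||g Ug gA] := witt_cancellation local h2 (d := d) (X := - A') (Y := - A).
- by rewrite linearN /= symA'.
- by rewrite linearN /= symA.
- exact: Ud.
- exact: UNA.
- apply: congruent_trans (congruent_block (congruent_sym Ad) (reflN _)) _.
  exact: congruent_trans BA (congruent_block Ad (reflN _)).
apply: congruent_sym; exists g => //.
by apply: oppr_inj; rewrite -gA mulmxN mulNmx.
Qed.
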